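(* Let $d$ and $N$ be integers with $d \geq 2$ and $N \geq 2$, and let $(c_1, c_2, c_3, \dots)$ be a nonincreasing sequence of numbers in $[0,1]$. Then there exists a strictly stationary random field $X := (X_k, k \in \mathbf{Z}^d)$ of real-valued random variables with the following properties: (A) $X_{\mathbf{0}}$ is uniformly distributed on $[0,1]$; (B) $X$ satisfies $N$-tuplewise independence; (C) $\rho^*(X,n) = 1$ for every positive integer $n$, and $\rho(X,1) = \rho'(X,1) = 1$; (D) for every integer $n \geq 2$, $\rho(X,n) = \rho'(X,n) = c_n$.
   Context: All random variables are defined on a common probability space $(\Omega,\mathcal{F},P)$. For $k\in\mathbf{Z}^d$, $k=(k_1,\dots,k_d)$ and $\|k\|$ is the Euclidean norm; for nonempty disjoint $S,T\subset\mathbf{Z}^d$, $\mathrm{dist}(S,T)=\min_{s\in S,t\in T}\|s-t\|$ (and for subsets of $\mathbf{Z}$, $\mathrm{dist}(G,H)=\min_{g\in G,h\in H}|g-h|$). $\mathbf{0}=(0,\dots,0)$. A random field $X=(X_k,k\in\mathbf{Z}^d)$ satisfies $N$-tuplewise independence if for every choice of $N$ distinct $k(1),\dots,k(N)\in\mathbf{Z}^d$ the random variables $X_{k(1)},\dots,X_{k(N)}$ are independent. For $\sigma$-fields $\mathcal{A},\mathcal{B}\subset\mathcal{F}$: $\rho(\mathcal{A},\mathcal{B}) := \sup|\mathrm{Corr}(f,g)|$ over all square-integrable $f$ that are $\mathcal{A}$-measurable and $g$ that are $\mathcal{B}$-measurable. For a random field $X$ and $n\in\mathbf{N}$: $\rho(X,n)$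 is the supremum of $\rho(\sigma(X_k,k\in S),\sigma(X_k,k\in T))$ over all pairs $S=\{k\in\mathbf{Z}^d:k_u\le j\}$, $T=\{k\in\mathbf{Z}^d:k_u\ge j+n\}$ with $j\in\mathbf{Z}$, $u\in\{1,\dots,d\}$; $\rho'(X,n)$ is the same supremum over all $S=\{k:k_u\in G\}$, $T=\{k:k_u\in H\}$ with $u\in\{1,\dots,d\}$ and $G,H\subset\mathbf{Z}$ nonempty, disjoint, $\mathrm{dist}(G,H)\ge n$; $\rho^*(X,n)$ is the same supremum over all nonempty disjoint $S,T\subset\mathbf{Z}^d$ with $\mathrm{dist}(S,T)\ge n$. *)

(* Defs.v *)
From HB Require Import structures.
From mathcomp Require Import all_boot all_order all_algebra.
From mathcomp Require Import all_classical all_reals all_analysis.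
Set Implicit Arguments. Unset Strict Implicit. Unset Printing Implicit Defensive.
Import Order.TTheory GRing.Theory Num.Theory.
Local Open Scope classical_set_scope.
Local Open Scope ring_scope.

Definition Zd (dim : nat) := 'rV[int]_dim.
Definition coord dim (k : Zd dim) (u : 'I_dim) : int := k ord0 u.

Definition eucl_norm (R : realType) dim (k : Zd dim) : R :=
  Num.sqrt (\sum_(u < dim) ((coord k u)%:~R) ^+ 2).

Section Fields.
Context {dd : measure_display} {Omega : measurableType dd} {R : realType}.
Variable (P : probability Omega R).

Definition gen_sigma dim (X : Zd dim -> Omega -> R) (S : set (Zd dim))
  : set (set Omega) :=
  <<s [set A | exists k, S k /\ exists B : set R, measurable B /\ A = X k @^-1` B] >>.

Definition measurable_wrt (F : set (set Omega)) (f : Omega -> R) : Prop :=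
  forall B : set R, measurable B -> F (f @^-1` B).

Definition sq_integrable (f : Omega -> R) : Prop := f \in Lfun P 2%:E.

(* correlation (convention: 0 if one of the variances vanishes, since x/0 = 0) *)
Definition corr (f g : Omega -> R) : R :=
  fine (covariance P f g) / Num.sqrt (fine ('V_P[f]) * fine ('V_P[g])).

Definition rho_sigma (A B : set (set Omega)) : R :=
  sup [set r | exists f g, [/\ sq_integrable f, measurable_wrt A f,
                              sq_integrable g, measurable_wrt B g &
                              r = `|corr f g|] ].

Definition rho_X dim (X : Zd dim -> Omega -> R) (n : nat) : R :=
  sup [set r | exists (j : int) (u : 'I_dim),
         r = rho_sigma (gen_sigma X [set k | coord k u <= j])
                       (gen_sigma X [set k | j + n%:Z <= coord k u])].

Definition rho'_X dim (X : Zd dim -> Omega -> R) (n : nat) : R :=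
  sup [set r | exists (u : 'I_dim) (G H : set int),
         [/\ G !=set0, H !=set0, [disjoint G & H],
             (forall g h, G g -> H h -> n%:Z <= `|g - h|) &
         r = rho_sigma (gen_sigma X [set k | G (coord k u)])
                       (gen_sigma X [set k | H (coord k u)])]].

Definition rhostar_X dim (X : Zd dim -> Omega -> R) (n : nat) : R :=
  sup [set r | exists (S T : set (Zd dim)),
         [/\ S !=set0, T !=set0, [disjoint S & T],
             (forall s t, S s -> T t -> n%:R <= eucl_norm R (s - t)) &
         r = rho_sigma (gen_sigma X S) (gen_sigma X T)]].

Definition random_field dim (X : Zd dim -> Omega -> R) : Prop :=
  forall k, measurable_fun setT (X k).

Definition strictly_stationary dim (X : Zd dim -> Omega -> R) : Prop :=
  forall (m : nat) (ks : 'I_m -> Zd dim) (B : 'I_m -> set R) (j : Zd dim),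
    (forall i, measurable (B i)) ->
    P (\bigcap_(i in [set: 'I_m]) (X (ks i + j) @^-1` B i))
    = P (\bigcap_(i in [set: 'I_m]) (X (ks i) @^-1` B i)).

Definition uniform01 (Y : Omega -> R) : Prop :=
  forall B : set R, measurable B ->
    P (Y @^-1` B) = (@lebesgue_measure R) (B `&` `[0, 1]%classic).

Definition tuplewise_indep dim (N : nat) (X : Zd dim -> Omega -> R) : Prop :=
  forall (ks : 'I_N -> Zd dim) (B : 'I_N -> set R),
    injective ks -> (forall i, measurable (B i)) ->
    P (\bigcap_(i in [set: 'I_N]) (X (ks i) @^-1` B i))
    = (\prod_(i < N) P (X (ks i) @^-1` B i))%E.

End Fields.

(* Main.v *)
From HB Require Import structures.
From mathcomp Require Import all_boot all_order all_algebra.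
From mathcomp Require Import all_classical all_reals all_analysis.
From mathcomp Require Import measurable_realfun zify lra ring.
Require Import Defs.
Import Order.TTheory GRing.Theory Num.Theory.
Import numFieldNormedType.Exports.
Local Open Scope classical_set_scope.
Local Open Scope ring_scope.

Set Implicit Arguments.
Unset Strict Implicit.
Unset Printing Implicit Defensive.

(* The field is X_k = sum_i 2^-(i+1) e_i(k), where e_0(k), e_1(k), ... are bits read off
   independent blocks: for each label b and each translate j there is a block of bits
   placed at the sites j + kappa b s, s < m b.  A block is uniform except that the product
   of its m b signs has mean c b, so any m b - 1 of its bits are fair and independent.
   As m b > N, this gives uniform marginals and N-tuplewise independence.
   - Lower bounds: the binary digits of X_k recover the bits almost surely.  If S and S'
     split the sites of a block with label b, the partial sign products over S and S' are
     centred with correlation c b.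
   - Upper bounds: blocks not split by S, S' do not correlate the two sides, split ones
     contribute at most their coefficient, and correlations of independent pairs of sigma-fields
     combine as a supremum (Csaki and Fischer).  A block whose sites form a chain with
     steps shorter than n cannot be covered by slabs at distance n unless one slab contains it, so
     the blocks split by slabs at distance n >= 2 have coefficient at most c n (c is nonincreasing).
   Labels with coefficient c n use an arithmetic progression of step n along one axis; labels
   with coefficient 1 use a long diagonal and one distant corner whose coordinates, taken
   one at a time, occur on the diagonal: these are split by sets at large Euclidean distance
   but never by slabs at distance 2. *)

(** * Biased bits from one uniform variable *)

(** Why a parity: relative to fair bits a block has density [1 + c * chi], where [chi] is the
    product of all its signs. No proper subset of the bits sees [chi], yet [chi] factors into one
    sign product per side whenever the block is split. The covariance of a function of one side with
    a function of the other is then [c] times a product of two Fourier coefficients, and Bessel's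
    inequality makes [c] the exact maximal correlation of a split block. The two sides meet
    infinitely many blocks, and the test functions are arbitrary square-integrable ones. The upper
    bound is therefore proved by finite sums for functions of finitely many bits and extended by
    density; the approximants must read only bits of their own side, so density is proved separately
    for each set of sites. The lower bound meets another obstacle: a sign product must be measurable
    for the field itself, not for the underlying bits, so it is rebuilt from binary digits, which
    return the bits only almost surely. The blocks with coefficient 1 are split by slabs at distance
    1. This makes both coefficients equal to 1 at [n = 1], whatever [c 1] is. *)

Definition unif01 (R : realType) : set (measurableTypeR R) -> \bar R :=
  mrestr (@lebesgue_measure R) (measurable_itv `[0, 1[).

HB.instance Definition _ (R : realType) :=
  Measure.copy (@unif01 R) (mrestr (@lebesgue_measure R) (measurable_itv `[0, 1[)).

Lemma unif01_setT (R : realType) : @unif01 R setT = 1%E.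
Proof.
by rewrite /unif01 /mrestr setTI lebesgue_measure_itv/= lte_fin ltr01 -EFinB subr0.
Qed.

HB.instance Definition _ (R : realType) :=
  Measure_isProbability.Build _ _ R (@unif01 R) (@unif01_setT R).

Section sampler.
Variables (R : realType) (beta : nat -> R).
Hypothesis beta1 : forall n, `|beta n| <= 1.

(** Normalised so that the sign [(-1) ^+ a] has mean [b]. *)
Definition bitwt (b : R) (a : bool) : R := (1 + b * (-1) ^+ a) / 2.

Lemma bitwt_ge0 b a : `|b| <= 1 -> 0 <= bitwt b a.
Proof. by rewrite ler_norml /bitwt => /andP[? ?]; case: a => /=; rewrite ?expr0 ?expr1; lra. Qed.

Lemma bitwtD b : bitwt b false + bitwt b true = 1.
Proof. by rewrite /bitwt /= expr0 expr1; lra. Qed.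

(* Histories are stored most recent bit first. *)
Fixpoint hist_wt (w : seq bool) : R :=
  if w is a :: w' then hist_wt w' * bitwt (beta (size w')) a else 1.

(** A history [w] is coded by the interval [[hist_lo w, hist_lo w + hist_wt w[]; the next bit cuts
    it, [false] taking the left piece and [true] the right one. Half-open intervals make this an
    exact partition, which is why [unif01] lives on [[0, 1[]. *)
Fixpoint hist_lo (w : seq bool) : R :=
  if w is a :: w' then
    hist_lo w' + (if a then hist_wt w' * bitwt (beta (size w')) false else 0)
  else 0.

Fixpoint hist (n : nat) (x : R) : seq bool :=
  if n is n'.+1 then
    (hist_lo (hist n' x) + hist_wt (hist n' x) * bitwt (beta n') false <= x)
      :: hist n' x
  else [::].

Definition sample (n : nat) (x : R) : bool := head false (hist n.+1 x).

Lemma size_hist n x : size (hist n x) = n.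
Proof. by elim: n => //= n ->. Qed.

Lemma hist_wt_ge0 w : 0 <= hist_wt w.
Proof. by elim: w => //= a w IH; rewrite mulr_ge0// bitwt_ge0. Qed.

Lemma histS n x : hist n.+1 x = sample n x :: hist n x.
Proof. by []. Qed.

Lemma histP n x w : 0 <= x < 1 -> size w = n ->
  (hist n x == w) = (hist_lo w <= x < hist_lo w + hist_wt w).
Proof.
move=> x01; elim: n w => [|n IH] [|a w]//=; first by rewrite add0r x01.
move=> [sw]; rewrite eqseq_cons IH// sw.
have [/eqP hw|hw] := boolP (hist n x == w).
  rewrite hw; move: (hw) => /eqP; rewrite IH// => /andP[h1 h2].
  rewrite h1 h2 andbT.
  have := bitwtD (beta n); move: h1 h2.
  set l := hist_lo w; set p := hist_wt w; set u := bitwt _ _; set v := bitwt _ _.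
  move=> h1 h2 uv; rewrite andbT.
  case: a; rewrite ?addr0.
    rewrite eqb_id -/v; case: (leP (l + p * u) x) => //= h3.
    by rewrite -addrA -mulrDr uv mulr1 h2.
  by rewrite -/u h1 /=; case: (leP (l + p * u) x).
(* If the earlier bits already differ from [w], then [x] is outside the interval of [w], hence
   outside the smaller interval of [a :: w]. *)
move: (hw); rewrite IH// => /negbTE hw'; rewrite hw' andbF; apply/esym.
apply: contraFF hw'.
have u0 := bitwt_ge0 false (beta1 n); have v0 := bitwt_ge0 true (beta1 n).
have := bitwtD (beta n); have := hist_wt_ge0 w.
set l := hist_lo w; set p := hist_wt w; set u := bitwt _ _; set v := bitwt _ _.
move=> p0 uv.
have pe : p = p * u + p * v by rewrite -mulrDr uv mulr1.
have pu : 0 <= p * u by rewrite mulr_ge0.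
have pv : 0 <= p * v by rewrite mulr_ge0.
by case: a => /=; rewrite -/u -/v => /andP[h1 h2]; apply/andP; split; lra.
Qed.

Lemma measurable_hist n w : measurable [set x : R | hist n x = w].
Proof.
elim: n w => [|n IH] [|a w] /=.
- by rewrite (_ : [set _ | _] = setT)//; apply/seteqP; split.
- by rewrite (_ : [set _ | _] = set0)//; apply/seteqP; split.
- by rewrite (_ : [set _ | _] = set0)//; apply/seteqP; split.
pose c := hist_lo w + hist_wt w * bitwt (beta n) false.
rewrite (_ : [set _ | _] =
    [set x | hist n x = w] `&` [set x | (c <= x) = a]); last first.
  apply/seteqP; split => x /=.
    by move=> [<- hw]; rewrite /c -hw.
  by rewrite /c => -[hw <-]; rewrite hw.
apply: measurableI => //; case: a.
  rewrite (_ : [set _ | _] = `[c, +oo[%classic); first exact: measurable_itv.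
  by apply/seteqP; split => x /=; rewrite in_itv/= andbT.
rewrite (_ : [set _ | _] = `]-oo, c[%classic); first exact: measurable_itv.
by apply/seteqP; split => x /=; rewrite in_itv/= ltNge; [move/negbT|move/negbTE].
Qed.

Lemma unif01_hist n w : size w = n ->
  unif01 [set x | hist n x = w] = (hist_wt w)%:E.
Proof.
move=> sw; rewrite /unif01 /mrestr.
have lo0 : 0 <= hist_lo w.
  elim: {n sw} w => //= a w IH; rewrite addr_ge0//; case: a => //.
  by rewrite mulr_ge0 ?hist_wt_ge0 ?bitwt_ge0.
have hi1 : hist_lo w + hist_wt w <= 1.
  elim: {n sw lo0} w => [|a w IH]/=; first by rewrite add0r.
  apply: le_trans IH; rewrite -[in leRHS](mulr1 (hist_wt w)) -(bitwtD (beta (size w))).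
  rewrite -addrA lerD2l mulrDr; case: a; rewrite ?add0r ?lerDl//.
  by rewrite mulr_ge0 ?hist_wt_ge0 ?bitwt_ge0.
rewrite (_ : _ `&` _ = `[hist_lo w, hist_lo w + hist_wt w[%classic); last first.
  apply/seteqP; split => x /=; rewrite !in_itv/=.
    by move=> [h x01]; rewrite -(histP x01 sw) h.
  move=> h; have x01 : 0 <= x < 1.
    by case/andP: h => h1 h2; rewrite (le_trans lo0 h1) (lt_le_trans h2 hi1).
  by split=> //; apply/eqP; rewrite histP.
rewrite lebesgue_measure_itv/= lte_fin ltrDl; case: ltP => h.
  by rewrite -EFinD addrC addKr.
by congr EFin; apply/eqP; rewrite eq_le hist_wt_ge0 h.
Qed.

Lemma measurable_sample n : measurable [set x | sample n x].
Proof.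
rewrite (_ : [set _ | _] =
  \bigcup_(w in [set: seq bool]) [set x | hist n.+1 x = true :: w]).
  apply: countable_bigcupT_measurable => // w; exact: measurable_hist.
apply/seteqP; split => x.
  by move=> sx; exists (hist n x) => //; rewrite /mkset histS sx.
by move=> [w _]; rewrite /mkset histS => -[].
Qed.

Lemma measurable_sampleE n a : measurable [set x | sample n x = a].
Proof.
have m := measurable_sample n; case: a => //.
rewrite (_ : [set _ | _] = ~` [set x | sample n x]); first exact: measurableC.
by apply/seteqP; split => x /=; case: sample.
Qed.

Lemma measurable_samples k n (F : pred nat) (a : nat -> bool) :
  measurable [set x | forall i, (k <= i < k + n)%N -> F i -> sample i x = a i].
Proof.
rewrite (_ : [set _ | _] = \bigcap_(i in [set i | (k <= i < k + n)%N /\ F i])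
  [set x | sample i x = a i]).
  by apply: bigcap_measurableType => i _; exact: measurable_sampleE.
by apply/seteqP; split => x /= h i => [[? ?]|? ?]; apply: h.
Qed.

(** Prescribing the whole history before [k] anchors the induction on [n]. An index where [F] fails
    is summed out, as its two weights add up to 1. *)
Lemma unif01_hist_sample n k w (F : pred nat) (a : nat -> bool) : size w = k ->
  unif01 ([set x | hist k x = w] `&`
          [set x | forall i, (k <= i < k + n)%N -> F i -> sample i x = a i])
  = (hist_wt w * \prod_(k <= i < k + n | F i) bitwt (beta i) (a i))%:E.
Proof.
elim: n k w => [|n IH] k w sw.
  rewrite addn0 big_geq// mulr1 -(unif01_hist sw); congr (unif01 _).
  apply/seteqP; split => x /= => [[]//|h]; split=> // i /andP[ki ik].
  by have := leq_ltn_trans ki ik; rewrite ltnn.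
rewrite big_ltn_cond ?ltnS ?leq_addr//; last by rewrite -addSnnS leq_addr.
pose E b := [set x | hist k.+1 x = b :: w] `&`
  [set x | forall i, (k.+1 <= i < k.+1 + n)%N -> F i -> sample i x = a i].
have mE b : measurable (E b).
  by apply: measurableI; [exact: measurable_hist|exact: measurable_samples].
have PE b : unif01 (E b) = (hist_wt w * bitwt (beta k) b *
    \prod_(k.+1 <= i < k.+1 + n | F i) bitwt (beta i) (a i))%:E.
  by rewrite IH/= ?sw.
have kn i : (k.+1 <= i < k.+1 + n)%N -> (k <= i < k.+1 + n)%N.
  by case/andP => /ltnW -> ->.
case: ifPn => Fk.
  rewrite -(addSnnS k) mulrA -PE; congr (unif01 _).
  apply/seteqP; split => x.
    move=> [h1 h2]; split; first by rewrite /mkset histS h1 h2// leqnn leq_addr.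
    by move=> i /kn; exact: h2.
  rewrite /E/= => -[[h0 h1] h2]; split => // i /andP[].
  rewrite leq_eqVlt => /orP[/eqP <- _ _|ki i1]; first by rewrite -h0.
  by apply: h2; rewrite ki.
rewrite -(addSnnS k).
have -> p : hist_wt w * p =
    hist_wt w * bitwt (beta k) false * p + hist_wt w * bitwt (beta k) true * p.
  by rewrite -mulrDl -mulrDr bitwtD mulr1.
have E0 : E false `&` E true = set0.
  by apply/seteqP; split => x //; rewrite /E/= => -[[[-> _] _] [[]]].
rewrite EFinD -!PE -(measureU (@unif01 R) (mE false) (mE true) E0).
congr (unif01 _); apply/seteqP; split => x.
  move=> [h1 h2]; case sk : (sample k x); [right|left]; split => [|i /kn].
  - by rewrite /mkset histS sk h1.
  - exact: h2.
  - by rewrite /mkset histS sk h1.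
  - exact: h2.
move=> [] [/= [h0 h1] h2]; split => // i /andP[];
  (rewrite leq_eqVlt => /orP[/eqP <- _|ki i1]; first by rewrite (negbTE Fk));
  by apply: h2; rewrite ki.
Qed.

Lemma unif01_sample (ts : seq nat) (a : nat -> bool) : uniq ts ->
  unif01 [set x | all (fun i => sample i x == a i) ts]
  = (\prod_(i <- ts) bitwt (beta i) (a i))%:E.
Proof.
move=> uts; pose n := (\max_(i <- ts) i.+1)%N.
have tn i : i \in ts -> (i < n)%N.
  by move=> its; rewrite /n (big_rem i)//= leq_maxl.
have := @unif01_hist_sample n 0 [::] (mem ts) a erefl; rewrite /= mul1r => H.
rewrite (_ : [set _ | _] = [set x | hist 0 x = [::]] `&`
  [set x | forall i, (0 <= i < 0 + n)%N -> mem ts i -> sample i x = a i]).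
  rewrite H; congr EFin; rewrite add0n -big_filter; apply: perm_big.
  apply: uniq_perm => //; first by rewrite filter_uniq// iota_uniq.
  move=> i; rewrite mem_filter mem_index_iota/=.
  by case: (boolP (i \in ts)) => //= /tn ->.
apply/seteqP; split => x /=.
  by move=> /allP h; split=> // i _ its; apply/eqP/h.
by move=> [_ h]; apply/allP => i its; rewrite h//=; exact: tn.
Qed.

End sampler.

(** * Binary expansions *)

Definition binary (R : realType) (v : nat -> bool) : R :=
  limn (fun n => \sum_(i < n) (v i)%:R * (2 ^- i.+1) : R).

Section binary.
Variable R : realType.
Implicit Type v : nat -> bool.

Lemma sum_half n : \sum_(i < n) (2 ^- i.+1) = 1 - 2 ^- n :> R.
Proof.
elim: n => [|n IH]; first by rewrite big_ord0 expr0 invr1 subrr.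
rewrite big_ord_recr /= IH exprS invfM; lra.
Qed.

Lemma is_cvg_binary v :
  cvgn (fun n => \sum_(i < n) (v i)%:R * (2 ^- i.+1) : R).
Proof.
apply: nondecreasing_is_cvgn.
  apply/nondecreasing_seqP => n; rewrite big_ord_recr/= lerDl.
  by rewrite mulr_ge0// invr_ge0 exprn_ge0.
exists 1 => _ [n _ <-]; apply: (@le_trans _ _ (\sum_(i < n) (2 ^- i.+1))).
  apply: ler_sum => i _; rewrite -[leRHS]mul1r ler_wpM2r ?invr_ge0 ?exprn_ge0//.
  by case: (v i).
by rewrite sum_half gerBl invr_ge0 exprn_ge0.
Qed.

Let b0 : nat -> R := fun _ => 0.

Let b01 : forall n, `|b0 n| <= 1.
Proof. by move=> n; rewrite normr0. Qed.

Definition digit := sample b0.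

(** With zero biases the interval of the first [n] bits has length [2 ^- n] and its left end is the
    partial sum, so the sums are squeezed to [x]. The opposite composition fails for expansions
    ending in ones and is recovered almost surely in [digit_binary_ae]. *)
Lemma binary_digit (x : R) : 0 <= x < 1 -> binary R (digit^~ x) = x.
Proof.
move=> x01; apply/cvg_lim => //.
have wt n : hist_wt b0 (hist b0 n x) = 2 ^- n.
  elim: n => [|n IH] /=; first by rewrite expr0 invr1.
  by rewrite IH /bitwt mul0r addr0 exprS invfM mulrC mul1r.
have lo n : hist_lo b0 (hist b0 n x) = \sum_(i < n) (digit i x)%:R * (2 ^- i.+1).
  elim: n => [|n IH]; first by rewrite big_ord0.
  rewrite big_ord_recr /= -/(digit n x) -IH.
  have -> : hist_lo b0 (hist b0 n x) + hist_wt b0 (hist b0 n x) * bitwt (b0 n) false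
      <= x = digit n x by [].
  case: (digit n x); rewrite ?mul0r ?addr0// size_hist wt /bitwt mul0r addr0 exprS invfM.
  by rewrite !mul1r mulrC.
rewrite (_ : (fun n => _) = (fun n => hist_lo b0 (hist b0 n x))); last first.
  by apply/funext => n; rewrite lo.
have key n : x - 2 ^- n <= hist_lo b0 (hist b0 n x) <= x.
  have := histP b01 x01 (size_hist b0 n x); rewrite eqxx => /esym/andP[-> h].
  by rewrite andbT lerBlDr ltW// -(wt n).
apply: (@squeeze_cvgr _ _ _ _ (fun n => x - 2 ^- n) (cst x)) => //.
- by near=> n; exact: key.
- rewrite -[X in _ --> X]subr0; apply: cvgB; first exact: cvg_cst.
  rewrite (_ : (fun n => 2 ^- n) = (fun n => (2^-1 : R) ^+ n)); last first.
    by apply/funext => n; rewrite exprVn.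
  by apply: cvg_expr; rewrite ger0_norm ?invr_ge0// invf_lt1// ltr1n.
- exact: cvg_cst.
Unshelve. all: by end_near.
Qed.

Lemma measurable_digit n : measurable [set x : R | digit n x].
Proof. exact: measurable_sample. Qed.

Lemma unif01_digit (ts : seq nat) (a : nat -> bool) : uniq ts ->
  unif01 [set x | all (fun i => digit i x == a i) ts] = (2 ^- size ts)%:E.
Proof.
move=> uts; rewrite (unif01_sample b01)//; congr EFin.
rewrite (eq_bigr (fun=> 2^-1)); first by rewrite big_const_seq count_predT iter_mulr_1 exprVn.
by move=> i _; rewrite /bitwt mul0r addr0 mul1r.
Qed.

End binary.

(** * Spaces of bits *)

Definition cyl (J : Type) (l : seq (J * bool)) : set (J -> bool) :=
  [set v | all (fun q => v q.1 == q.2) l].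

Definition bitspace (J : Type) := g_sigma_algebraType (range (@cyl J)).

HB.instance Definition _ (J : Type) := Measurable.on (bitspace J).

Section bitspace.
Variable J : eqType.

Lemma cyl_cat (l l' : seq (J * bool)) : cyl (l ++ l') = cyl l `&` cyl l'.
Proof. by apply/seteqP; split => v; rewrite /cyl /= all_cat => /andP. Qed.

Lemma cyl_nil : cyl [::] = [set: J -> bool].
Proof. by apply/seteqP; split. Qed.

Lemma measurable_cyl (l : seq (J * bool)) : measurable (cyl l : set (bitspace J)).
Proof. by apply: sub_sigma_algebra; exists l. Qed.

(* A contradictory list describes the empty cylinder; listing them too makes
   cylinders closed under intersection. *)
Lemma cyl_uniq (l : seq (J * bool)) : cyl l = set0 \/
  exists ts a, uniq ts /\ cyl l = [set v : J -> bool | all (fun t => v t == a t) ts].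
Proof.
have [c|nc] := pselect (exists t, (t, true) \in l /\ (t, false) \in l).
  left; apply/seteqP; split => v //; case: c => t [l1 l2] /allP h.
  by move: (h _ l1) (h _ l2) => /= /eqP ->.
right; exists (undup [seq q.1 | q <- l]), (fun t => (t, true) \in l).
split; first exact: undup_uniq.
have key q : q \in l -> ((q.1, true) \in l) = q.2.
  case: q => t [] //= tl; apply/negP => tl'; apply: nc; exists t; split => //.
apply/seteqP; split => v /allP h; apply/allP.
  by move=> t; rewrite mem_undup => /mapP[q ql ->]; rewrite key//; exact: h.
by move=> q ql /=; rewrite -(key q ql); apply: h; rewrite mem_undup map_f.
Qed.

Lemma measurable_bit (t : J) b : measurable [set v : bitspace J | v t = b].
Proof.
rewrite (_ : [set _ | _] = cyl [:: (t, b)]); first exact: measurable_cyl.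
by apply/seteqP; split => v; rewrite /cyl /= andbT => /eqP.
Qed.

Lemma measurable_to_bitspace d (T : measurableType d) (f : T -> bitspace J) :
  (forall t, measurable [set x | f x t]) -> measurable_fun setT f.
Proof.
move=> mf; apply: (@measurability _ _ T (bitspace J) setT f (range (@cyl J))) => //.
move=> _ [_ [l _ <-] <-]; rewrite setTI.
have mfb t b : measurable [set x | f x t = b].
  have := mf t; case: b => // /measurableC.
  rewrite (_ : ~` _ = [set x | f x t = false])//.
  by apply/seteqP; split => x /=; case: (f x t).
elim: l => [|q l IH]; first by rewrite cyl_nil preimage_setT; exact: measurableT.
rewrite (_ : _ @^-1` _ = [set x | f x q.1 = q.2] `&` (f @^-1` cyl l)).
  exact: measurableI.
apply/seteqP; split => x; rewrite /cyl /=.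
  by move=> /andP[/eqP].
by move=> [-> ->]; rewrite eqxx.
Qed.

Lemma bitspace_unique (R : realType) (m1 m2 : {measure set (bitspace J) -> \bar R}) :
  (m1 setT < +oo)%E -> (forall l, m1 (cyl l) = m2 (cyl l)) ->
  forall A, measurable A -> m1 A = m2 A.
Proof.
move=> fin h A mA.
apply: (g_sigma_algebra_measure_unique
  (range (@cyl J) : set (set (bitspace J))) _ (fun=> setT)) => //.
- by move=> _ [l _ <-]; exact: measurable_cyl.
- by move=> _; exists [::] => //; exact: cyl_nil.
- by apply/seteqP; split => // v _; exists 0%N.
- by move=> _ _ [l _ <-] [l' _ <-]; exists (l ++ l') => //; exact: cyl_cat.
- by move=> _ [l _ <-].
Qed.

Lemma eq_law (R : realType) d d' (T : measurableType d) (T' : measurableType d')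
    (P : probability T R) (P' : probability T' R)
    (f : T -> bitspace J) (f' : T' -> bitspace J) :
  measurable_fun setT f -> measurable_fun setT f' ->
  (forall ts a, uniq ts -> P [set x | all (fun t => f x t == a t) ts]
                         = P' [set x | all (fun t => f' x t == a t) ts]) ->
  forall A, measurable A -> P (f @^-1` A) = P' (f' @^-1` A).
Proof.
move=> mf mf' h A mA.
have [fT hf] : exists fT : {mfun T >-> bitspace J}, (fT : T -> bitspace J) = f.
  by exists (mfun_Sub (mem_set mf)).
have [fT' hf'] : exists fT : {mfun T' >-> bitspace J}, (fT : T' -> bitspace J) = f'.
  by exists (mfun_Sub (mem_set mf')).
rewrite -hf -hf'.
apply: (@bitspace_unique _ (pushforward P fT) (pushforward P' fT')) => //.
  by rewrite -[X in (X < _)%E]/(P setT) probability_setT ltry.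
move=> l; rewrite /= /pushforward hf hf'.
have [->|[ts [a [uts ->]]]] := cyl_uniq l; first by rewrite !preimage_set0 !measure0.
exact: h.
Qed.

End bitspace.

Section bernoulli.
Variables (R : realType) (J : countType) (beta : J -> R).
Hypothesis beta1 : forall t, `|beta t| <= 1.

(** A countable product of two-point measures, obtained as the law of a function of a single uniform
    variable: the sampler is indexed by the codes of [J] in [nat], and numbers that code nothing get
    bias 0. *)
Lemma bernoulli_exists : exists P : probability (bitspace J) R,
  forall ts a, uniq ts -> P [set v | all (fun t => v t == a t) ts]
    = (\prod_(t <- ts) bitwt (beta t) (a t))%:E.
Proof.
pose b n := oapp beta 0 (unpickle n).
have b1 n : `|b n| <= 1.
  by rewrite /b; case: (unpickle n) => [t|] //=; rewrite normr0.
pose f (x : measurableTypeR R) : bitspace J := fun t => sample b (pickle t) x.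
have mf : measurable_fun setT f.
  by apply: measurable_to_bitspace => t; exact: measurable_sample.
have [fT hf] : exists fT : {mfun _ >-> bitspace J}, (fT : _ -> bitspace J) = f.
  by exists (mfun_Sub (mem_set mf)).
exists (distribution (@unif01 R) fT) => ts a uts.
rewrite /distribution /= /pushforward hf.
pose a' n := oapp a true (unpickle n).
have := unif01_sample b1 a' (_ : uniq (map pickle ts)).
rewrite map_inj_uniq; last exact: (pcan_inj pickleK).
move=> /(_ uts); rewrite big_map => H; rewrite (_ : _ @^-1` _ =
    [set x | all (fun i => sample b i x == a' i) (map pickle ts)]).
  by rewrite H; congr EFin; apply: eq_bigr => t _; rewrite /b /a' pickleK.
apply/seteqP; split => x /=; rewrite all_map /f => /allP h; apply/allP => t tts /=;
  by have := h t tts; rewrite /= /a' pickleK.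
Qed.

End bernoulli.

(** * Fair bits, the uniform law and decoding *)

Section fair_bits.
Variable R : realType.

Lemma measurable_binary : measurable_fun setT (@binary R : bitspace nat -> R).
Proof.
apply: (@measurable_fun_cvg _ _ _ _
  (fun n (v : bitspace nat) => \sum_(i < n) (v i)%:R * (2 ^- i.+1) : R)).
  move=> n; apply: measurable_sum => i; apply: measurable_funM => //.
  rewrite (_ : (fun x => _) = \1_[set v : bitspace nat | v i = true]).
    by apply: measurable_indic; exact: measurable_bit.
  apply/funext => v; rewrite indicE.
  by case: (boolP (v i)) => vi; [rewrite mem_set|rewrite memNset//=; exact/negP].
by move=> v _; exact: is_cvg_binary.
Qed.

Definition fair d (T : measurableType d) (P : probability T R) (J : eqType)
    (f : T -> bitspace J) :=
  forall ts a, uniq ts ->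
    P [set x | all (fun t => f x t == a t) ts] = (2 ^- size ts)%:E.

(** All fair sequences have the same law, so a question about one of them can be settled on the
    digits of a uniform variable, where [binary] is explicitly inverted. *)
Lemma fair_law d (T : measurableType d) (P : probability T R) (f : T -> bitspace nat) :
  measurable_fun setT f -> fair P f -> forall A, measurable A ->
  P (f @^-1` A) = unif01 [set x : R | A (@digit R ^~ x)].
Proof.
move=> mf ff A mA.
apply: (@eq_law _ R _ _ _ _ P (@unif01 R) f (fun x => @digit R ^~ x)) => //.
  by apply: measurable_to_bitspace => t; exact: measurable_digit.
by move=> ts a uts; rewrite ff//; apply/esym; exact: unif01_digit.
Qed.

Lemma fair_binary d (T : measurableType d) (P : probability T R) (f : T -> bitspace nat) :
  measurable_fun setT f -> fair P f -> forall B : set R, measurable B ->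
  P [set x | B (binary R (f x))] = lebesgue_measure (B `&` `[0, 1]%classic).
Proof.
move=> mf ff B mB.
have := fair_law mf ff (_ : measurable ((@binary R : bitspace nat -> R) @^-1` B)).
rewrite /= => ->; last first.
  by rewrite -[X in measurable X]setTI; apply: measurable_binary.
rewrite -[RHS](_ : unif01 B = _).
  rewrite /unif01 /mrestr; congr lebesgue_measure.
  by apply/seteqP; split => x /= [Bx x01]; split => //; move: Bx;
    rewrite /preimage/= (binary_digit x01).
rewrite /unif01 /mrestr.
(* The digits live on [[0, 1[]; the endpoint 1 is a null set. *)
have -> : `[0, 1]%classic = `[0, 1[%classic `|` [set 1] :> set R.
  by rewrite setUitv1// bnd_simp.
have mB01 : measurable (B `&` `[0, 1[%classic : set R).
  by apply: measurableI => //; exact: measurable_itv.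
have mB1 : measurable (B `&` [set 1] : set R) by exact: measurableI.
rewrite setIUr measureU//=.
- rewrite [X in (_ + X)%E](_ : _ = 0%E) ?adde0//; apply/eqP.
  rewrite -measure_le0 -(@lebesgue_measure_set1 R 1).
  by apply: le_measure; rewrite ?inE//; exact: subIsetr.
- apply/seteqP; split => x // -[[_ +] [_ x1]].
  by rewrite x1 /= in_itv/= ltxx andbF.
Qed.

Lemma digit_binary_ae d (T : measurableType d) (P : probability T R)
    (f : T -> bitspace nat) i :
  measurable_fun setT f -> fair P f ->
  P [set x | digit i (binary R (f x)) = f x i] = 1%E.
Proof.
move=> mf ff.
pose A := [set v : bitspace nat | digit i (binary R v) = v i].
have mA : measurable A.
  rewrite (_ : A = ([set v | digit i (binary R v)] `&` [set v | v i = true]) `|`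
    (~` [set v | digit i (binary R v)] `&` [set v | v i = false])).
    have m1 : measurable ((@binary R : bitspace nat -> R) @^-1` [set x | digit i x]).
      rewrite -[X in measurable X]setTI.
      exact: (measurable_binary measurableT (measurable_digit i)).
    apply: measurableU; apply: measurableI; try exact: measurable_bit.
      exact: m1.
    exact: measurableC.
  apply/seteqP; split => v /=; rewrite /A/=.
    by case: (digit i _) => <-; [left|right].
  by move=> [[-> ->]|[/negP/negbTE -> ->]].
have -> : [set x | digit i (binary R (f x)) = f x i] = f @^-1` A by [].
rewrite (fair_law mf ff)// -(probability_setT (@unif01 R)).
rewrite /unif01 /= /mrestr; congr lebesgue_measure.
apply/seteqP; split => x /=; rewrite in_itv/= => -[]// _ x01; split=> //.
by rewrite /A/= binary_digit.
Qed.

End fair_bits.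

(** * Independence of groups of fair bits *)

Section group_independence.
Variables (R : realType) (d : measure_display) (T : measurableType d).
Variables (P : probability T R) (N : nat) (f : 'I_N -> T -> bitspace nat).
Hypothesis mf : forall i, measurable_fun setT (f i).
Hypothesis ff : forall (ts : seq ('I_N * nat)) a, uniq ts ->
  P [set x | all (fun t => f t.1 x t.2 == a t) ts] = (2 ^- size ts)%:E.

Let mfA i (A : set (bitspace nat)) : measurable A -> measurable (f i @^-1` A).
Proof. by move=> mA; rewrite -[X in measurable X]setTI; exact: mf. Qed.

Let E (C : 'I_N -> set (bitspace nat)) := \bigcap_(i in [set: 'I_N]) (f i @^-1` C i).

Let mE C : (forall i, measurable (C i)) -> measurable (E C).
Proof. by move=> mC; apply: fin_bigcap_measurable => // i _; exact: mfA. Qed.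

Let fair_i i : fair P (f i).
Proof.
move=> ts a uts.
have := @ff [seq (i, t) | t <- ts] (fun q => a q.2).
rewrite map_inj_uniq ?size_map; last by move=> ? ? [].
by move=> /(_ uts) <-; congr (P _); apply/seteqP; split => x /=; rewrite all_map.
Qed.

Let indep_cyl (C : 'I_N -> set (bitspace nat)) :
  (forall i, range (@cyl nat) (C i)) ->
  P (E C) = (\prod_(i < N) P (f i @^-1` C i))%E.
Proof.
move=> cC.
have [[i Ci]|nC] := pselect (exists i, C i = set0).
  rewrite (_ : E C = set0); last first.
    by apply/seteqP; split => x // /(_ i Logic.I); rewrite Ci.
  by rewrite measure0 (bigD1 i)//= Ci preimage_set0 measure0 mul0e.
have {}cC i : exists ta : seq nat * (nat -> bool), uniq ta.1 /\
    C i = [set v : nat -> bool | all (fun t => v t == ta.2 t) ta.1].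
  have [l _ Cl] := cC i; have [l0|[ts [a [uts h]]]] := cyl_uniq l.
    by exfalso; apply: nC; exists i; rewrite -Cl l0.
  by exists (ts, a); rewrite -Cl.
have [ta hta] := choice cC.
pose s := [seq (i, t) | i <- enum 'I_N, t <- (ta i).1].
have us : uniq s.
  apply: allpairs_uniq_dep; first exact: enum_uniq.
    by move=> i _; case: (hta i).
  by move=> [? ?] [? ?] _ _ /= [-> ->].
have -> : E C = [set x | all (fun q => f q.1 x q.2 == (ta q.1).2 q.2) s].
  apply/seteqP; split => x /= h.
    apply/allP => _ /allpairsPdep[i [t [_ ti ->]]] /=.
    have := h i Logic.I; rewrite /preimage/= (hta i).2 => /allP; exact.
  move=> i _; rewrite /preimage/= (hta i).2; apply/allP => t ti.
  move/allP : h => /(_ (i, t)); apply; apply/allpairsPdep; exists i, t.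
  by rewrite mem_enum.
rewrite (ff _ us) (eq_bigr (fun i => (2 ^- size (ta i).1)%:E)); last first.
  by move=> i _; rewrite (hta i).2; exact: (fair_i _ _ (hta i).1).
rewrite size_allpairs_dep prodEFin; congr EFin.
rewrite -exprVn; under [RHS]eq_bigr do rewrite -exprVn.
by rewrite sumnE big_map big_enum/= -expr_sum.
Qed.

(** Cylinders are replaced by measurable sets one coordinate at a time: at stage [r], the
    coordinates from [r] on are still cylinders. *)
Lemma bits_independent (C : 'I_N -> set (bitspace nat)) :
  (forall i, measurable (C i)) ->
  P (E C) = (\prod_(i < N) P (f i @^-1` C i))%E.
Proof.
suff H r : forall C : 'I_N -> set (bitspace nat), (forall i, measurable (C i)) ->
    (forall i : 'I_N, (r <= i)%N -> range (@cyl nat) (C i)) ->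
    P (E C) = (\prod_(i < N) P (f i @^-1` C i))%E.
  by move=> mC; apply: (H N) => // i; rewrite leqNgt ltn_ord.
elim: r => [|r IH] {}C mC cC; first by apply: indep_cyl => i; exact: cC.
have [rN|Nr] := ltnP r N; last first.
  by apply: IH => // i ri; have := leq_trans Nr ri; rewrite leqNgt ltn_ord.
pose i0 := Ordinal rN.
pose C' D := fun i => if i == i0 then D else C i.
have mC' D : measurable D -> forall i, measurable (C' D i).
  by move=> mD i; rewrite /C'; case: ifP.
have setTC : range (@cyl nat) setT by exists [::] => //; exact: cyl_nil.
pose K := E (C' setT).
have mK : measurable K by apply: mE; apply: mC'; exact: measurableT.
have EC' D : E (C' D) = f i0 @^-1` D `&` K.
  apply/seteqP; split => x.
    move=> h; split; first by have := h i0 Logic.I; rewrite /C' eqxx.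
    by move=> i _; rewrite /C'; case: eqP => // /eqP ni; have := h i Logic.I;
      rewrite /C' (negbTE ni).
  move=> [hD hK] i _; rewrite /C'; case: eqP => [->//|/eqP ni].
  by have := hK i Logic.I; rewrite /C' (negbTE ni).
have IH' D : range (@cyl nat) D ->
    P (E (C' D)) = (P (f i0 @^-1` D) * \prod_(i < N | i != i0) P (f i @^-1` C i))%E.
  move=> cD; rewrite IH.
  - rewrite (bigD1 i0)//= /C' eqxx; congr (_ * _)%E.
    by apply: eq_bigr => i /negbTE ->.
  - by apply: mC'; case: cD => l _ <-; exact: measurable_cyl.
  - move=> i ri; rewrite /C'; case: eqP => // /eqP ni; apply: cC.
    rewrite ltn_neqAle ri andbT; apply: contra ni => /eqP h.
    by apply/eqP/val_inj.
have KE : P K = (\prod_(i < N | i != i0) P (f i @^-1` C i))%E.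
  by rewrite IH'// preimage_setT probability_setT mul1e.
have fK : P K \is a fin_num by exact: fin_num_measure.
have K0 : 0 <= fine (P K) by exact: fine_ge0.
(* As functions of the event in coordinate [i0], the joint probability and its product form are
   finite measures; the induction hypothesis says that they agree on cylinders. *)
pose m1 : {measure set (bitspace nat) -> \bar R} := pushforward (mrestr P mK) (f i0).
pose m2 : {measure set (bitspace nat) -> \bar R} :=
  mscale (NngNum K0) (pushforward P (f i0)).
have key D : measurable D -> m1 (mf i0) D = m2 (mf i0) D.
  apply: bitspace_unique => [|l].
    rewrite /= /pushforward /mrestr preimage_setT setTI.
    by rewrite -ge0_fin_numE.
  rewrite /m1 /m2 /= /pushforward /mrestr /mscale /= -EC' IH'; last by exists l.
  by rewrite -KE fineK// muleC.
have -> : E C = E (C' (C i0)).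
  by congr E; apply/funext => i; rewrite /C'; case: eqP => // ->.
rewrite EC'; have := key _ (mC i0).
rewrite /m1 /m2 /= /pushforward /mrestr /mscale /= => ->.
by rewrite [RHS](bigD1 i0)//= -KE fineK// muleC.
Qed.

End group_independence.

(** * Blocks with a parity bias *)

(** Label, translate, number within the block. Numbers [s >= m b] lie beyond the block and index
    fair padding bits, so that every label has the same index type. *)
Definition site dim := ((nat * Zd dim) * nat)%type.

Definition translate dim (j : Zd dim) (v : bitspace (site dim)) : bitspace (site dim) :=
  fun t => v ((t.1.1, t.1.2 + j), t.2).

Definition flip dim (ts : seq (site dim)) (v : bitspace (site dim)) : bitspace (site dim) :=
  fun t => v t (+) (t \in ts).

Lemma measurable_translate dim (j : Zd dim) : measurable_fun setT (translate j).
Proof. by apply: measurable_to_bitspace => t; exact: (measurable_bit _ true). Qed.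

Lemma measurable_flip dim (ts : seq (site dim)) : measurable_fun setT (flip ts).
Proof.
apply: measurable_to_bitspace => t; rewrite /flip.
rewrite (_ : [set _ | _] = [set v : bitspace (site dim) | v t = (t \notin ts)]).
  exact: measurable_bit.
by apply/seteqP; split => v /=; case: (v t); case: (t \in ts).
Qed.

Lemma xor_delta (s k n : nat) : \big[addb/false]_(k <= i < n) (i == s) = (k <= s < n)%N.
Proof.
have [kn|kn] := boolP (k <= s < n)%N.
  rewrite (bigD1_seq s) ?iota_uniq ?mem_index_iota//= eqxx big1// => i /negbTE ->.
  by [].
rewrite big_nat_cond big1// => i; rewrite andbT => ki; apply/negbTE.
by apply: contra kn => /eqP <-.
Qed.

Lemma sign_xor (R : pzRingType) (x : nat -> bool) n :
  (-1) ^+ (\big[addb/false]_(0 <= i < n) x i) = \prod_(i < n) (-1) ^+ x i :> R.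
Proof.
by rewrite big_mkord; apply: (big_morph (fun b : bool => (-1) ^+ b)) => // b c; exact: signr_addb.
Qed.

Section block_measure.
Variables (R : realType) (dim : nat) (m : nat -> nat) (c : nat -> R).
Hypotheses (m_gt0 : forall b, (0 < m b)%N) (c1 : forall b, `|c b| <= 1).

Local Notation I := (site dim).

Let beta (t : I) : R := if t.2 == 0%N then c t.1.1 else 0.

Let beta1 t : `|beta t| <= 1.
Proof. by rewrite /beta; case: eqP => // _; rewrite normr0. Qed.

(** Adding the parity of the other bits to bit 0 makes the parity of the output block equal to
    source bit 0, the only biased one. *)
Let V (e : bitspace I) : bitspace I := fun t =>
  if t.2 == 0%N then e t (+) \big[addb/false]_(1 <= i < m t.1.1) e (t.1, i) else e t.

Let mV : measurable_fun setT V.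
Proof.
apply: measurable_to_bitspace => t; rewrite /V.
case: (t.2 == 0%N); last exact: (measurable_bit _ true).
have mx s : forall a, measurable [set e : bitspace I | \big[addb/false]_(i <- s) e (t.1, i) = a].
  elim: s => [|i s IH] a.
    case: a.
      rewrite (_ : [set _ | _] = set0); first exact: measurable0.
      by apply/seteqP; split => e //=; rewrite big_nil.
    rewrite (_ : [set _ | _] = setT); first exact: measurableT.
    by apply/seteqP; split => e //=; rewrite big_nil.
  rewrite (_ : [set _ | _] =
     ([set e : bitspace I | e (t.1, i) = true] `&`
       [set e : bitspace I | \big[addb/false]_(i <- s) e (t.1, i) = ~~ a]) `|`
     ([set e : bitspace I | e (t.1, i) = false] `&`
       [set e : bitspace I | \big[addb/false]_(i <- s) e (t.1, i) = a])).
    by apply: measurableU; apply: measurableI => //; exact: measurable_bit.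
  apply/seteqP; split => e /=; rewrite big_cons.
    by case: (e _) => /= <-; [left|right]; rewrite ?negbK.
  by move=> [[-> ->]|[-> ->]]//=; rewrite negbK.
rewrite (_ : [set _ | _] =
     ([set e : bitspace I | e t = true] `&`
       [set e : bitspace I | \big[addb/false]_(1 <= i < m t.1.1) e (t.1, i) = false]) `|`
     ([set e : bitspace I | e t = false] `&`
       [set e : bitspace I | \big[addb/false]_(1 <= i < m t.1.1) e (t.1, i) = true])).
  by apply: measurableU; apply: measurableI => //; exact: measurable_bit.
apply/seteqP; split => e /=.
  by case: (e t) => /= h; [left|right]; split => //; apply/negbTE.
by move=> [[-> ->]|[-> ->]].
Qed.

(** Flipping two output bits keeps their parity, hence source bit 0, so only unbiased source bits
    need to be flipped. If [s] or [s'] is 0, output bit 0 flips by itself through the parity. *)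
Let V_flip (b : nat) j s s' e : (s < m b)%N -> (s' < m b)%N -> s != s' ->
  V (flip [seq t <- [:: (b, j, s); (b, j, s')] | t.2 != 0%N] e) =
  flip [:: (b, j, s); (b, j, s')] (V e).
Proof.
move=> sm s'm ss'; set l := [seq t <- _ | t.2 != 0%N].
have lE t : (t \in l) = (t.2 != 0%N) && (t \in [:: (b, j, s); (b, j, s')]).
  exact: mem_filter.
clearbody l; apply/funext => -[q i].
rewrite /V /flip /=; have [i0|i0] := eqVneq i 0%N; last by rewrite lE/= i0.
rewrite i0 lE/= addbF big_split/= addbA; congr (_ (+) _).
have [->|nq] := eqVneq q (b, j); last first.
  rewrite !inE !xpair_eqE (negbTE nq) big1// => k _.
  by rewrite lE !inE !xpair_eqE (negbTE nq) andbF.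
rewrite (eq_big_nat _ _ (F2 := fun k => (k == s) (+) (k == s'))); last first.
  move=> k /andP[k0 _]; rewrite lE !inE !xpair_eqE !eqxx/= -lt0n k0/=.
  by have [->|_] := eqVneq k s; [rewrite (negbTE ss')|case: eqP].
rewrite big_split/= !xor_delta !inE !xpair_eqE !eqxx/= sm s'm !andbT !lt0n.
rewrite ![0%N == _]eq_sym; move: ss'.
by clear; case: s => [|s]; case: s'.
Qed.

Let V_flip1 (b : nat) j s e : (m b <= s)%N ->
  V (flip [:: (b, j, s)] e) = flip [:: (b, j, s)] (V e).
Proof.
move=> ms; apply/funext => -[q i].
rewrite /V /flip /=; have [i0|//] := eqVneq i 0%N.
rewrite big_split/= addbACA; congr (_ (+) _).
rewrite [X in _ (+) X]big_nat_cond big1 ?addbF// => k; rewrite andbT => /andP[_ km].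
rewrite !inE !xpair_eqE; case: eqP => //= qe; apply/eqP => ks.
by move: km; rewrite ks qe/= ltnNge ms.
Qed.

(* The bits of a block (b, j) are uniform up to a parity bias: the first bit is
   chosen so that the product of the first m b signs has expectation c b. *)
Lemma block_measure_exists : exists mu : probability (bitspace I) R,
  [/\ forall j A, measurable A -> mu (translate j @^-1` A) = mu A,
      forall b j s s' A, (s < m b)%N -> (s' < m b)%N -> s != s' -> measurable A ->
        mu (flip [:: (b, j, s); (b, j, s')] @^-1` A) = mu A,
      forall b j s A, (m b <= s)%N -> measurable A ->
        mu (flip [:: (b, j, s)] @^-1` A) = mu A &
      forall M (Q : seq (nat * Zd dim)) (x : nat * Zd dim -> nat -> bool),
        uniq Q -> (forall q, q \in Q -> (m q.1 <= M)%N) ->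
        mu [set v | forall q s, q \in Q -> (s < M)%N -> v (q, s) = x q s] =
        (\prod_(q <- Q) (2 ^- M * (1 + c q.1 * \prod_(s < m q.1) (-1) ^+ x q s)))%:E].
Proof.
have [P HP] := bernoulli_exists beta1.
have P_flip ts A : all (fun t : I => t.2 != 0%N) ts -> measurable A ->
    P (flip ts @^-1` A) = P A.
  move=> /allP ts0 mA.
  apply: (@eq_law _ R _ _ _ _ P P (flip ts) id) => //; first exact: measurable_flip.
  move=> us a uus; rewrite (HP us a uus).
  rewrite (_ : [set x | _] = [set v | all (fun t => v t == a t (+) (t \in ts)) us]).
    rewrite (HP us (fun t => a t (+) (t \in ts)) uus); congr EFin.
    apply: eq_bigr => t _; case: (boolP (t \in ts)) => [/ts0|_]; last by rewrite addbF.
    by rewrite /beta => /negbTE ->; rewrite /bitwt !mul0r.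
  by apply/seteqP; split => v /= /allP h; apply/allP => t /h; rewrite /flip;
    case: (v t); case: (a t); case: (t \in ts).
pose mu0 : probability (bitspace I) R := distribution P (mfun_Sub (mem_set mV)).
exists mu0; split.
- move=> j A mA; rewrite /mu0 /distribution /= /pushforward /=.
  have mVA : measurable (V @^-1` A) by rewrite -[X in measurable X]setTI; exact: mV.
  rewrite -[LHS]/(P (translate j @^-1` (V @^-1` A))).
  apply: (@eq_law _ R _ _ _ _ P P (translate j) id) => //; first exact: measurable_translate.
  move=> us a uus; rewrite (HP us a uus).
  pose g (t : I) : I := ((t.1.1, t.1.2 + j), t.2).
  pose g' (t : I) : I := ((t.1.1, t.1.2 - j), t.2).
  have gK : cancel g g' by move=> [[b k] s]; rewrite /g /g' /= addrK.
  have ug : uniq (map g us) by rewrite (map_inj_uniq (can_inj gK)).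
  have := HP _ (a \o g') ug; rewrite big_map.
  under eq_bigr do rewrite /= gK; move=> <-; congr (P _).
  by apply/seteqP; split => v /=; rewrite all_map => /allP h; apply/allP => t /h /=;
    rewrite gK.
- move=> b j s s' A sm s'm ss' mA; rewrite /mu0 /distribution /= /pushforward /=.
  have mVA : measurable (V @^-1` A) by rewrite -[X in measurable X]setTI; exact: mV.
  rewrite -[RHS](@P_flip [seq t <- [:: (b, j, s); (b, j, s')] | t.2 != 0%N])//.
    congr (P _); apply/seteqP; split => e; rewrite /preimage/=;
    by have := V_flip j e sm s'm ss' => /= ->.
  exact: filter_all.
- move=> b j s A ms mA; rewrite /mu0 /distribution /= /pushforward /=.
  have mVA : measurable (V @^-1` A) by rewrite -[X in measurable X]setTI; exact: mV.
  rewrite -[RHS](@P_flip [:: (b, j, s)])//.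
    congr (P _); apply/seteqP; split => e; rewrite /preimage/=;
    by have := V_flip1 j e ms => /= ->.
  by rewrite /= andbT -lt0n (leq_trans _ ms).
- move=> M Q x uQ mM.
  (* [y] is the source that [V] maps to [x]: its bit 0 is the full parity of [x]. *)
  pose y (t : I) := if t.2 == 0%N then \big[addb/false]_(0 <= i < m t.1.1) x t.1 i
                    else x t.1 t.2.
  pose ts : seq I := [seq (q, s) | q <- Q, s <- index_iota 0 M].
  have uts : uniq ts.
    by apply: allpairs_uniq => //; [exact: iota_uniq|move=> [? ?] [? ?] _ _ /= [-> ->]].
  transitivity (P [set e | all (fun t => e t == y t) ts]); last first.
    rewrite (HP _ _ uts); congr EFin; rewrite /ts big_allpairs; apply: eq_big_seq => q qQ.
    have M0 : (0 < M)%N by rewrite (leq_trans _ (mM q qQ)).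
    rewrite big_ltn//= /beta /y/= {1}/bitwt -sign_xor.
    rewrite [\prod_(1 <= i < M) _](eq_big_nat _ _ (F2 := fun=> 2^-1)); last first.
      by move=> i /andP[i0 _]; rewrite gtn_eqF// /bitwt mul0r addr0 mul1r.
    rewrite prodr_const_nat subn1 -mulrA [RHS]mulrC; congr (_ * _).
    by rewrite -exprS prednK// exprVn.
  have xor0 (f : nat -> bool) n : (0 < n)%N -> \big[addb/false]_(0 <= i < n) f i =
     f 0%N (+) \big[addb/false]_(1 <= i < n) f i by move=> n0; rewrite big_ltn.
  rewrite /mu0 /distribution /= /pushforward; congr (P _).
  apply/seteqP; split => e /= h.
    apply/allP => t /allpairsP[[q s] [/= qQ]]; rewrite mem_index_iota/= => sM ->.
    rewrite /y/=; have := h q s qQ sM; rewrite /V/=; case: eqP => [s0|_ -> //].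
    rewrite s0 => h0; apply/eqP; rewrite (xor0 _ _ (m_gt0 q.1)) -h0.
    rewrite (eq_big_nat _ _ (F1 := x q) (F2 := fun i => e (q, i))) => [|i /andP[i0 im]].
      by rewrite -addbA addbb addbF.
    by have := h q i qQ (leq_trans im (mM q qQ)); rewrite /V/= gtn_eqF.
  move=> q s qQ sM; have hy i : (i < M)%N -> e (q, i) = y (q, i).
    move=> iM; apply/eqP; move/allP: h; apply; apply/allpairsP; exists (q, i).
    by rewrite mem_index_iota.
  rewrite /V/= hy//; have [s0|s0] := eqVneq s 0%N; last by rewrite /y/= (negbTE s0).
  rewrite /y s0/= (xor0 _ _ (m_gt0 q.1)).
  rewrite (eq_big_nat _ _ (F1 := fun i => e (q, i)) (F2 := x q)) => [|i /andP[i0 im]].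
    by rewrite -addbA addbb addbF.
  by rewrite hy ?(leq_trans im (mM q qQ))// /y/= gtn_eqF.
Qed.

End block_measure.

(** * The field *)

Section field.
Variables (R : realType) (dim : nat) (m : nat -> nat) (kappa : nat -> nat -> Zd dim).
Variables (dec : nat -> nat * nat) (mu : probability (bitspace (site dim)) R).
Hypothesis m_gt0 : forall b, (0 < m b)%N.
Hypothesis kappa_inj : forall b i i', (i < m b)%N -> (i' < m b)%N ->
  kappa b i = kappa b i' -> i = i'.
Hypothesis dec_inj : injective dec.
Hypothesis mu_translate : forall j A, measurable A -> mu (translate j @^-1` A) = mu A.
Hypothesis mu_flip : forall b j s s' A,
  (s < m b)%N -> (s' < m b)%N -> s != s' -> measurable A ->
  mu (flip [:: (b, j, s); (b, j, s')] @^-1` A) = mu A.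
Hypothesis mu_flip1 : forall b j s A, (m b <= s)%N -> measurable A ->
  mu (flip [:: (b, j, s)] @^-1` A) = mu A.

Local Notation I := (site dim).

Lemma measurable_all_bits (ts : seq I) (a : I -> bool) :
  measurable [set v : bitspace I | all (fun t => v t == a t) ts].
Proof.
rewrite (_ : [set _ | _] = cyl [seq (t, a t) | t <- ts]); first exact: measurable_cyl.
by apply/seteqP; split => v; rewrite /cyl /= all_map.
Qed.

(* Flipping t together with a free bit of the same block preserves the measure, so
   both values of the bit at t are equally likely given the other bits. *)
Lemma free_sites_fair (F : set I) :
  (forall b j, exists2 s, (s < m b)%N & ~ F (b, j, s)) ->
  forall ts a, uniq ts -> (forall t, t \in ts -> F t) ->
  mu [set v | all (fun t => v t == a t) ts] = (2 ^- size ts)%:E.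
Proof.
move=> Ffree; elim=> [|t ts IH] a.
  move=> _ _; rewrite expr0 invr1 -(probability_setT mu); congr (mu _).
  by apply/seteqP; split.
move=> /= /andP[tts uts] hF.
pose A b := [set v : bitspace I | (v t == b) && all (fun t => v t == a t) ts].
have mA b : measurable (A b).
  rewrite (_ : A b = [set v : bitspace I | v t = b] `&`
      [set v : bitspace I | all (fun t => v t == a t) ts]).
    by apply: measurableI; [exact: measurable_bit|exact: measurable_all_bits].
  by apply/seteqP; split => v; rewrite /A/=; [move/andP => [/eqP]|move=> [-> ->]; rewrite eqxx].
have flipA us b : t \in us -> {in ts, forall t', t' \notin us} ->
    flip us @^-1` A b = A (~~ b).
  move=> tus htus; apply/seteqP; split => v; rewrite /A /preimage/flip/= tus addbT => /andP[h1 h2];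
    (apply/andP; split; first by move: h1; case: (v t); case: b);
    apply/allP => t' t'ts; move/allP : h2 => /(_ _ t'ts);
    by rewrite (negbTE (htus _ t'ts)) addbF.
have swap b : mu (A (~~ b)) = mu (A b).
  case: t hF tts @A mA flipA => -[b0 j] s hF tts A mA flipA.
  have [sm|ms] := ltnP s (m b0); last first.
    rewrite -[RHS](mu_flip1 j ms)// flipA// ?inE ?eqxx// => t' t'ts.
    by rewrite inE; apply: contraNneq tts => <-.
  have [s' s'm nF] := Ffree b0 j.
  have ss' : s != s'.
    by apply/eqP => ss'; apply: nF; rewrite -ss'; apply: hF; rewrite inE eqxx.
  rewrite -[RHS](mu_flip j sm s'm ss')// flipA// ?inE ?eqxx// => t' t'ts.
  rewrite !inE negb_or; apply/andP; split; first by apply: contraNneq tts => <-.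
  by apply/eqP => t'e; apply: nF; rewrite -t'e; apply: hF; rewrite inE t'ts orbT.
have AA : mu [set v | all (fun t => v t == a t) ts] = (mu (A true) + mu (A false))%E.
  rewrite -measureU//; last first.
    by apply/seteqP; split => v //; rewrite /A/= => -[]/andP[/eqP ->].
  congr (mu _); apply/seteqP; split => v; rewrite /A/=.
    by case: (v t) => ->; [left|right].
  by move=> [] /andP[].
have eA b : mu (A b) = mu (A true) by case: b => //; rewrite -(swap true).
rewrite -[LHS]/(mu (A (a t))) eA.
have fA : mu (A true) \is a fin_num by exact: fin_num_measure.
have hts t' : t' \in ts -> F t' by move=> t'ts; apply: hF; rewrite inE t'ts orbT.
have := IH a uts hts; rewrite AA (eA false) -(fineK fA) -EFinD => -[H].
by congr EFin; rewrite exprS invfM; lra.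
Qed.

(* The site of block label (dec i).1 numbered (dec i).2, in the translate that puts it at k. *)
Definition field_site (k : Zd dim) (i : nat) : I :=
  (((dec i).1, k - kappa (dec i).1 (dec i).2), (dec i).2).

Definition field (k : Zd dim) (v : bitspace I) : R :=
  binary R (fun i => v (field_site k i)).

(** Each bit is read at one site and by one digit only, so disjoint sets of sites read disjoint sets
    of bits. *)
Lemma field_site_inj k k' i i' : field_site k i = field_site k' i' -> k = k' /\ i = i'.
Proof.
rewrite /field_site => -[h1 h2 h3].
have ii' : i = i' by apply: dec_inj; rewrite (surjective_pairing (dec i)) h1 h3 -surjective_pairing.
by split=> //; move: h2; rewrite ii' => /addIr.
Qed.

Lemma measurable_field_sites k :
  measurable_fun setT (fun v : bitspace I => (fun i => v (field_site k i)) : bitspace nat).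
Proof. by apply: measurable_to_bitspace => i; exact: (measurable_bit _ true). Qed.

Lemma measurable_field k : measurable_fun setT (field k).
Proof.
exact: (measurableT_comp (@measurable_binary R) (measurable_field_sites k)).
Qed.

Lemma field_stationary : strictly_stationary mu field.
Proof.
move=> n ks B j mB.
have mS : measurable (\bigcap_(i in [set: 'I_n]) (field (ks i) @^-1` B i)).
  apply: fin_bigcap_measurable => // i _; rewrite -[X in measurable X]setTI.
  exact: measurable_field.
rewrite -[RHS](mu_translate j mS); congr (mu _).
have fE k v : field (k + j) v = field k (translate j v).
  rewrite /field /translate /field_site /=; congr (binary R _).
  by apply/funext => i; rewrite addrAC.
by apply/seteqP; split => v /= h i _; have := h i Logic.I; rewrite /preimage/= fE.
Qed.

Section sites.
Variables (N : nat) (ks : 'I_N -> Zd dim).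
Hypotheses (m_gtN : forall b, (N < m b)%N) (ks_inj : injective ks).

(** Pigeonhole: each block occupies more than [N] distinct sites, so [N] sites leave one of its bits
    unread and [free_sites_fair] applies. *)
Lemma sites_fair (ts : seq ('I_N * nat)) a : uniq ts ->
  mu [set v | all (fun t => v (field_site (ks t.1) t.2) == a t) ts]
    = (2 ^- size ts)%:E.
Proof.
move=> uts.
pose F := [set t : I | exists q : 'I_N * nat, field_site (ks q.1) q.2 = t].
have Ffree b j : exists2 s, (s < m b)%N & ~ F (b, j, s).
  apply: contrapT => nex.
  have allF (s : 'I_(m b)) : exists i : 'I_N, ks i = j + kappa b s.
    have [[[i n] h]|h] := pselect (F (b, j, nat_of_ord s)); last first.
      by exfalso; apply: nex; exists s.
    exists i; move: h; rewrite /field_site/= => -[h1 h2 h3].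
    by rewrite -h2 -h3 -h1 subrK.
  have [g hg] := choice allF.
  have /leq_card : injective g.
    move=> s s' ss'; apply/val_inj/(@kappa_inj b); rewrite /= ?ltn_ord//.
    by apply: (@addrI _ j); rewrite -!hg ss'.
  by rewrite !card_ord leqNgt m_gtN.
pose fs (q : 'I_N * nat) := field_site (ks q.1) q.2.
have fs_inj : injective fs.
  by move=> [i n] [i' n'] /field_site_inj [/= /ks_inj -> ->].
pose g t := if pselect (exists q, fs q = t) is left h then a (projT1 (cid h)) else true.
have gK q : g (fs q) = a q.
  rewrite /g; case: pselect => [h|[]]; last by exists q.
  by case: (cid h) => q' /= /fs_inj ->.
have := free_sites_fair Ffree (ts := map fs ts) g.
rewrite map_inj_uniq// size_map => /(_ uts) <-.
  by congr (mu _); apply/seteqP; split => v /=; rewrite all_map => /allP h; apply/allP => q /h /=;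
    rewrite gK.
by move=> t /mapP[q _ ->]; exists q.
Qed.

Lemma field_tuplewise (B : 'I_N -> set R) : (forall i, measurable (B i)) ->
  mu (\bigcap_(i in [set: 'I_N]) (field (ks i) @^-1` B i))
  = (\prod_(i < N) mu (field (ks i) @^-1` B i))%E.
Proof.
move=> mB; pose f (i : 'I_N) (v : bitspace I) : bitspace nat := fun n => v (field_site (ks i) n).
have mf i : measurable_fun setT (f i) by exact: measurable_field_sites.
have mC i : measurable ((@binary R : bitspace nat -> R) @^-1` B i).
  by rewrite -[X in measurable X]setTI; apply: measurable_binary.
have := bits_independent mf _ mC; apply => ts a uts; exact: sites_fair.
Qed.

End sites.

Lemma site_fair k : (forall b, 1 < m b)%N ->
  fair mu (fun v : bitspace I => (fun i => v (field_site k i)) : bitspace nat).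
Proof.
move=> m1 ts a uts.
have inj1 : injective (fun _ : 'I_1 => k) by move=> i i' _; rewrite !ord1.
have := @sites_fair 1 (fun=> k) m1 inj1 [seq (ord0, t) | t <- ts] (fun q => a q.2).
rewrite map_inj_uniq; last by move=> ? ? [].
move=> /(_ uts); rewrite size_map => <-; congr (mu _).
by apply/seteqP; split => v /=; rewrite all_map.
Qed.

Lemma field_uniform k : (forall b, 1 < m b)%N -> uniform01 mu (field k).
Proof.
move=> m1 B mB.
exact: (fair_binary (measurable_field_sites k) (site_fair k m1) mB).
Qed.

Lemma field_decode k i : (forall b, 1 < m b)%N ->
  mu [set v | digit i (field k v) = v (field_site k i)] = 1%E.
Proof.
move=> m1; exact: (digit_binary_ae i (measurable_field_sites k) (site_fair k m1)).
Qed.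

End field.

(** * Covariances over finitely many blocks *)

Section finite_covariance.
Variables (R : realFieldType) (M : nat) (K A B : pred 'I_M) (c r : R).
Local Notation T := {ffun 'I_M -> bool}.
Hypothesis AB : forall i, A i -> B i -> false.

Let chi (D : pred 'I_M) (x : T) : R := \prod_(i < M | D i) (-1) ^+ x i.
Let u (f : T -> R) : R := 2 ^- M * \sum_(x : T) f x.
(** Expectation under the density [1 + c * chi K] with respect to the uniform mean [u]. [K] marks
    the bits of the block among the [M] bits considered, [A] and [B] those read by the two sides. *)
Let E (f : T -> R) : R := \sum_(x : T) 2 ^- M * (1 + c * chi K x) * f x.
Let dep (D : pred 'I_M) (f : T -> R) :=
  forall x y : T, (forall i, D i -> x i = y i) -> f x = f y.

Let EuD f : E f = u f + c * u (fun x => chi K x * f x).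
Proof.
rewrite /E /u mulrCA -mulrDr [c * _]mulr_sumr -big_split/= mulr_sumr.
by apply: eq_bigr => x _; ring.
Qed.

Let u_cst (a : R) : u (fun=> a) = a.
Proof.
rewrite /u sumr_const card_ffun card_bool card_ord -(mulr_natl a) natrX mulrA.
by rewrite mulVf ?mul1r// expf_neq0// pnatr_eq0.
Qed.

Let uZ (a : R) f : u (fun x => a * f x) = a * u f.
Proof. by rewrite /u -mulr_sumr mulrCA. Qed.

Let uD f g : u (fun x => f x + g x) = u f + u g.
Proof. by rewrite /u big_split/= mulrDr. Qed.

Let u_ge0 f : (forall x, 0 <= f x) -> 0 <= u f.
Proof. by move=> f0; rewrite /u mulr_ge0 ?invr_ge0 ?exprn_ge0 ?sumr_ge0. Qed.

Let flip_at (j : 'I_M) (x : T) : T := [ffun i => x i (+) (i == j)].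

Let flip_atK j : involutive (flip_at j).
Proof. by move=> x; apply/ffunP => i; rewrite !ffunE addbK. Qed.

(** Flipping bit [j] changes the sign of [chi D] and leaves [f] alone, so the mean is its own
    opposite. *)
Let u_chi (D : pred 'I_M) (j : 'I_M) f : D j -> dep (fun i => i != j) f ->
  u (fun x : T => chi D x * f x) = 0.
Proof.
move=> Dj df; have : u (fun x => chi D x * f x) = - u (fun x => chi D x * f x).
  rewrite {1}/u (reindex_inj (can_inj (flip_atK j)))/= -[RHS]mulN1r -uZ /u.
  congr (_ * _); apply: eq_bigr => x _; rewrite mulrA; congr (_ * _); last first.
    by apply: df => i /negbTE; rewrite ffunE => ->; rewrite addbF.
  rewrite /chi (bigD1 j)//= [in RHS](bigD1 j)//= mulrA; congr (_ * _).
    by rewrite ffunE eqxx addbT signrN mulN1r.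
  by apply: eq_bigr => i /andP[_ /negbTE ij]; rewrite ffunE ij addbF.
lra.
Qed.

Let mix (D : pred 'I_M) (xy : T * T) : T * T :=
  ([ffun i => if D i then xy.1 i else xy.2 i], [ffun i => if D i then xy.2 i else xy.1 i]).

Let mixK D : involutive (mix D).
Proof.
by move=> [x y]; congr pair; apply/ffunP => i; rewrite /= !ffunE/= ?ffunE; case: (D i).
Qed.

(** Exchanging the coordinates outside [A] between two independent copies turns [f x * g x] into
    [f x * g y]. *)
Let u_indep f g : dep A f -> dep B g -> u (fun x => f x * g x) = u f * u g.
Proof.
move=> df dg.
have e2 h : u (fun x => u (fun y => h x y)) =
    2 ^- M * (2 ^- M * \sum_(p : T * T) h p.1 p.2).
  by rewrite /u -mulr_sumr pair_bigA.
have -> : u f * u g = u (fun x => u (fun y => f x * g y)).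
  by rewrite mulrC -uZ; congr u; apply/funext => x; rewrite mulrC -uZ.
have -> : u (fun x => f x * g x) = u (fun x => u (fun y => f x * g x)).
  by congr u; apply/funext => x; rewrite u_cst.
rewrite !e2; congr (_ * (_ * _)); rewrite (reindex_inj (can_inj (mixK A)))/=.
apply: eq_bigr => -[x y] _ /=; congr (_ * _).
  by apply: df => i Ai; rewrite ffunE Ai.
apply: dg => i Bi; rewrite ffunE; case: ifP => // Ai.
by case: (AB Ai Bi).
Qed.

Let chiM D x : chi D x * chi D x = 1.
Proof.
by rewrite /chi -big_split/= big1// => i _; rewrite -expr2 sqrr_sign.
Qed.

(** For the uniform mean [chi D] is a centred unit vector, so its squared coefficient in [f] is at
    most the variance of [f]. *)
Let bessel (D : pred 'I_M) (j : 'I_M) f : D j ->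
  u (fun x => chi D x * f x) ^+ 2 <= u (fun x => f x ^+ 2) - u f ^+ 2.
Proof.
move=> Dj; set a := u (fun x => chi D x * f x).
have chi0 : u (chi D) = 0.
  have := @u_chi D j (fun=> 1) Dj (fun _ _ _ => erefl).
  by under eq_fun do rewrite mulr1.
have : 0 <= u (fun x => (f x - u f - a * chi D x) ^+ 2) by apply: u_ge0 => x; exact: sqr_ge0.
have -> : (fun x => (f x - u f - a * chi D x) ^+ 2) =
   (fun x => f x ^+ 2 + (- (2 * u f) * f x + (u f ^+ 2 + ((- (2 * a)) * (chi D x * f x) +
      ((2 * u f * a) * chi D x + a ^+ 2))))).
  apply/funext => x; have := chiM D x; move: (chi D x) => h hh.
  have -> : a ^+ 2 = a ^+ 2 * (h * h) by rewrite hh mulr1.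
  ring.
rewrite !uD !u_cst !uZ chi0 -/a mulr0 add0r => H.
by rewrite -subr_ge0; apply: le_trans H _; rewrite le_eqVlt; apply/orP; left; apply/eqP; ring.
Qed.

Hypotheses (c01 : 0 <= c <= 1) (r0 : 0 <= r) (K0 : exists j, K j).

Let w_ge0 x : 0 <= 2 ^- M * (1 + c * chi K x).
Proof.
rewrite mulr_ge0 ?invr_ge0 ?exprn_ge0//.
have : -1 <= chi K x.
  have := chiM K x => /eqP; rewrite -subr_eq0.
  have -> : chi K x * chi K x - 1 = (chi K x - 1) * (chi K x + 1) by ring.
  by rewrite mulf_eq0 => /orP[]/eqP h; lra.
by case/andP: c01 => ? ? ?; nra.
Qed.

Let E_cst a : E (fun=> a) = a.
Proof.
case: K0 => j Kj; rewrite EuD u_cst -[X in u X](_ : (fun x => chi K x * (fun=> a) x) = _)//.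
by rewrite (u_chi Kj) ?mulr0 ?addr0.
Qed.

Let E_var f : 0 <= E (fun x => f x ^+ 2) - E f ^+ 2.
Proof.
have : 0 <= E (fun x => (f x - E f) ^+ 2).
  by apply: sumr_ge0 => x _; rewrite mulr_ge0 ?sqr_ge0.
have -> : E (fun x => (f x - E f) ^+ 2) =
    E (fun x => f x ^+ 2) + (- (2 * E f) * E f + E (fun=> E f ^+ 2)).
  rewrite {2 5}/E mulr_sumr -!big_split/=; apply: eq_bigr => x _.
  by rewrite -/(E f); ring.
by rewrite E_cst => H; apply: le_trans H _; rewrite le_eqVlt; apply/orP; left; apply/eqP; ring.
Qed.

(* By scaling, 2 cov <= r (var f + var g) for all f, g is the same as |corr| <= r, but this
   additive form is inherited by averages over independent blocks. *)
Lemma block_covariance f g : dep A f -> dep B g ->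
  ((forall i, K i -> A i || B i) -> (exists2 i, K i & A i) -> (exists2 i, K i & B i) -> c <= r) ->
  2 * (E (fun x => f x * g x) - E f * E g) <=
  r * ((E (fun x => f x ^+ 2) - E f ^+ 2) + (E (fun x => g x ^+ 2) - E g ^+ 2)).
Proof.
move=> df dg split_r.
have VfVg : 0 <= r * ((E (fun x => f x ^+ 2) - E f ^+ 2) + (E (fun x => g x ^+ 2) - E g ^+ 2)).
  by rewrite mulr_ge0// addr_ge0.
have cov0 : E (fun x => f x * g x) = E f * E g ->
    2 * (E (fun x => f x * g x) - E f * E g) <= r *
    ((E (fun x => f x ^+ 2) - E f ^+ 2) + (E (fun x => g x ^+ 2) - E g ^+ 2)).
  by move=> ->; rewrite subrr mulr0.
have E_u j h : K j -> dep (fun i => i != j) h -> E h = u h.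
  by move=> Kj dh; rewrite EuD (u_chi Kj dh) mulr0 addr0.
have sub_dep (D D' : pred 'I_M) h : (forall i, D i -> D' i) -> dep D h -> dep D' h.
  by move=> DD' dh x y xy; apply: dh => i /DD'; exact: xy.
have neqA j : ~~ A j -> forall i, A i -> i != j.
  by move=> Aj i Ai; apply: contraNneq Aj => <-.
have neqB j : ~~ B j -> forall i, B i -> i != j.
  by move=> Bj i Bi; apply: contraNneq Bj => <-.
(* If a bit of the block is read by neither side, the bias averages out and uniform independence
   remains. *)
have [[j Kj /norP[Aj Bj]]|KAB] := pselect (exists2 j, K j & ~~ (A j || B j)).
  apply: cov0; have dfj := sub_dep _ _ _ (neqA _ Aj) df.
  have dgj := sub_dep _ _ _ (neqB _ Bj) dg.
  rewrite !(E_u j)//; first exact: u_indep.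
  by move=> x y xy; rewrite (dfj _ _ xy) (dgj _ _ xy).
have {}KAB i : K i -> A i || B i by move=> Ki; apply: contrapT => /negP h; apply: KAB; exists i.
have chi_dep (D D' : pred 'I_M) h : (forall i, D i -> D' i) -> dep D' h ->
    dep D' (fun x => chi D x * h x).
  move=> DD' dh x y xy; rewrite (dh _ _ xy) /chi; congr (_ * _).
  by apply: eq_bigr => i /DD' /xy ->.
(* If one side reads the whole block, [chi K] is absorbed into the function of that side, and the
   covariance again vanishes. *)
have [[j1 Kj1 Aj1]|nA] := pselect (exists2 i, K i & A i); last first.
  have KB i : K i -> B i.
    by move=> Ki; case/orP: (KAB i Ki) => // Ai; exfalso; apply: nA; exists i.
  case: K0 => j Kj; have Aj : ~~ A j by apply/negP => Aj; apply: nA; exists j.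
  apply: cov0; rewrite (E_u j f Kj (sub_dep _ _ _ (neqA _ Aj) df)) !EuD mulrDr.
  rewrite (u_indep df dg); congr (_ + _).
  rewrite [RHS]mulrCA; congr (_ * _); rewrite -(u_indep df (chi_dep _ _ _ KB dg)).
  by congr u; apply/funext => x; rewrite mulrCA.
have [[j2 Kj2 Bj2]|nB] := pselect (exists2 i, K i & B i); last first.
  have KA i : K i -> A i.
    by move=> Ki; case/orP: (KAB i Ki) => // Bi; exfalso; apply: nB; exists i.
  case: K0 => j Kj; have Bj : ~~ B j by apply/negP => Bj; apply: nB; exists j.
  apply: cov0; rewrite (E_u j g Kj (sub_dep _ _ _ (neqB _ Bj) dg)) !EuD mulrDl.
  rewrite (u_indep df dg); congr (_ + _).
  rewrite -mulrA; congr (_ * _); rewrite -(u_indep (chi_dep _ _ _ KA df) dg).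
  by congr u; apply/funext => x; rewrite mulrA.
(* The block is split. Each side misses a bit of it, so means and variances are the uniform ones;
   only the mean of the product sees the bias, through two Fourier coefficients. *)
have cr : c <= r by apply: split_r => //; [exists j1|exists j2].
have Aj2 : ~~ A j2 by apply/negP => h; have := AB h Bj2.
have Bj1 : ~~ B j1 by apply/negP => h; have := AB Aj1 h.
have sq_dep D h : dep D h -> dep D (fun x => h x ^+ 2) by move=> dh x y /dh ->.
have dfj := sub_dep _ _ _ (neqA _ Aj2) df.
have dgj := sub_dep _ _ _ (neqB _ Bj1) dg.
rewrite (E_u j2 f)// (E_u j1 g)// (E_u j2 (fun x => f x ^+ 2))//; last exact: sq_dep.
rewrite (E_u j1 (fun x => g x ^+ 2))//; last exact: sq_dep.
pose KA := [pred i | K i && A i]; pose KB := [pred i | K i && B i].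
have chiKE x : chi K x = chi KA x * chi KB x.
  rewrite /chi (bigID A)/=; congr (_ * _); apply: eq_bigl => i /=.
  case: (boolP (K i)) => //= Ki; have := KAB i Ki.
  by case: (boolP (A i)) => //= Ai _; apply/esym/negP => Bi; have := AB Ai Bi.
have -> : E (fun x => f x * g x) = u f * u g +
    c * (u (fun x => chi KA x * f x) * u (fun x => chi KB x * g x)).
  rewrite EuD (u_indep df dg) -(u_indep (f := fun x => chi KA x * f x)).
  - congr (_ + _ * u _); apply/funext => x; rewrite chiKE; ring.
  - by apply: chi_dep df => i /andP[].
  - by apply: chi_dep dg => i /andP[].
have Ha : u (fun x => chi KA x * f x) ^+ 2 <= u (fun x => f x ^+ 2) - u f ^+ 2.
  by apply: (@bessel _ j1); rewrite /KA/= Kj1.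
have Hb : u (fun x => chi KB x * g x) ^+ 2 <= u (fun x => g x ^+ 2) - u g ^+ 2.
  by apply: (@bessel _ j2); rewrite /KB/= Kj2.
move: Ha Hb; set a := u (fun x => chi KA x * f x); set b := u (fun x => chi KB x * g x).
set vf := _ - u f ^+ 2; set vg := _ - u g ^+ 2 => Ha Hb.
have -> : u f * u g + c * (a * b) - u f * u g = c * (a * b) by ring.
case/andP: c01 => c0 _.
apply: (@le_trans _ _ (c * (a ^+ 2 + b ^+ 2))).
  rewrite -subr_ge0 (_ : _ - _ = c * (a - b) ^+ 2); last by ring.
  by rewrite mulr_ge0 ?sqr_ge0.
apply: (@le_trans _ _ (r * (a ^+ 2 + b ^+ 2))).
  by rewrite ler_wpM2r// addr_ge0 ?sqr_ge0.
by rewrite ler_wpM2l// lerD.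
Qed.

(** Bit [k] of the block is missing from [D], which removes the bias; bit [j] then averages [chi D]
    to 0. *)
Lemma block_sign_mean (D : pred 'I_M) j k : D j -> K k -> ~~ D k -> E (chi D) = 0.
Proof.
move=> Dj Kk Dk; rewrite EuD (u_chi Kk); last first.
  move=> x y xy; apply: eq_bigr => i Di; rewrite xy//.
  by apply: contraNneq Dk => <-.
rewrite mulr0 addr0; have := @u_chi D j (fun=> 1) Dj (fun _ _ _ => erefl).
by under eq_fun do rewrite mulr1.
Qed.

Lemma block_sign_product : E (chi K) = c.
Proof.
case: K0 => j Kj; rewrite EuD.
under eq_fun do rewrite chiM.
rewrite u_cst mulr1 [u _](_ : _ = 0) ?add0r//.
have := @u_chi K j (fun=> 1) Kj (fun _ _ _ => erefl).
by under eq_fun do rewrite mulr1.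
Qed.

Lemma block_weight_ge0 (x : T) : 0 <= 2 ^- M * (1 + c * \prod_(i < M | K i) (-1) ^+ x i).
Proof. exact: w_ge0. Qed.

End finite_covariance.

Section block_average.
Variables (R : realType) (dim : nat) (m : nat -> nat) (c : nat -> R) (M : nat) (r : R).
Hypotheses (m_gt0 : forall b, (0 < m b)%N) (c01 : forall b, 0 <= c b <= 1) (r0 : 0 <= r).

Local Notation I := (site dim).
Local Notation T := {ffun 'I_M -> bool}.
Local Notation config := (bitspace I).

Definition depends_on (U : Type) (S : set I) (F : config -> U) :=
  forall v w, (forall t, S t -> v t = w t) -> F v = F w.

Definition set_block (q : nat * Zd dim) (x : T) (v : config) : config := fun t =>
  if t.1 == q then (if insub t.2 is Some i then x i else v t) else v t.

Definition block_weight (b : nat) (x : T) : R :=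
  2 ^- M * (1 + c b * \prod_(i < M | (i < m b)%N) (-1) ^+ x i).

(** The conditional expectation of [F] given all bits other than the first [M] of each block in [Q],
    written as an explicit finite sum. *)
Fixpoint block_avg (Q : seq (nat * Zd dim)) (F : config -> R) : config -> R :=
  if Q is q :: Q' then
    fun v => \sum_(x : T) block_weight q.1 x * block_avg Q' F (set_block q x v)
  else F.

Lemma block_avg_dep S Q F : depends_on S F -> depends_on S (block_avg Q F).
Proof.
elim: Q => //= q Q IH dF v w vw; apply: eq_bigr => x _; congr (_ * _).
apply: (IH dF) => t St; rewrite /set_block; case: ifP => _; last exact: vw.
by case: insubP => // _; exact: vw.
Qed.

Lemma block_avg_set_block Q q x F v : q \notin Q ->
  block_avg Q (F \o set_block q x) v = block_avg Q F (set_block q x v).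
Proof.
elim: Q v => //= q' Q IH v; rewrite inE negb_or => /andP[/negbTE qq' qQ].
apply: eq_bigr => y _; rewrite IH//; congr (_ * block_avg _ _ _).
apply/funext => t; rewrite /set_block.
by have [->|_] := eqVneq t.1 q; [rewrite qq'|case: ifP].
Qed.

(** Law of total covariance: with block [q] set apart, the covariance is the mean of the conditional
    covariances plus the covariance of the conditional means. The induction hypothesis bounds the
    first term and [block_covariance] the second; the right-hand sides add up because variances
    decompose in the same way. *)
Lemma block_avg_covariance S S' Q F G v :
  (forall t, S t -> S' t -> False) -> depends_on S F -> depends_on S' G ->
  (forall q, q \in Q -> (m q.1 <= M)%N) ->
  (forall q, (forall s, (s < m q.1)%N -> S (q, s) \/ S' (q, s)) ->
     (exists2 s, (s < m q.1)%N & S (q, s)) -> (exists2 s, (s < m q.1)%N & S' (q, s)) ->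
     c q.1 <= r) ->
  2 * (block_avg Q (fun v => F v * G v) v - block_avg Q F v * block_avg Q G v) <=
  r * ((block_avg Q (fun v => F v ^+ 2) v - block_avg Q F v ^+ 2) +
       (block_avg Q (fun v => G v ^+ 2) v - block_avg Q G v ^+ 2)).
Proof.
move=> SS' dF dG + split_r; elim: Q v => [|q Q IH] v mQ /=; first by lra.
have mqM : (m q.1 <= M)%N by apply: mQ; rewrite inE eqxx.
have {}mQ q' : q' \in Q -> (m q'.1 <= M)%N by move=> q'Q; apply: mQ; rewrite inE q'Q orbT.
pose A (i : 'I_M) := `[< S (q, nat_of_ord i) >]; pose B (i : 'I_M) := `[< S' (q, nat_of_ord i) >].
have AB i : A i -> B i -> false by move=> /asboolP s /asboolP s'; case: (SS' _ s s').
have dep D H : depends_on D H -> forall x y : T,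
    (forall i : 'I_M, `[< D (q, nat_of_ord i) >] -> x i = y i) ->
    block_avg Q H (set_block q x v) = block_avg Q H (set_block q y v).
  move=> dH x y xy; apply: (block_avg_dep Q dH) => -[q' s] Dt.
  rewrite /set_block/=; case: eqP => // qq'; case: insubP => //= i _ si.
  by apply: xy; rewrite si -qq'; apply/asboolP.
pose K := [pred i : 'I_M | (i < m q.1)%N].
have K0 : exists j, K j.
  by exists (Ordinal (leq_trans (m_gt0 q.1) mqM)); rewrite /K/= m_gt0.
have := @block_covariance R M K A B (c q.1) r AB (c01 q.1) r0 K0
  (fun x => block_avg Q F (set_block q x v)) (fun x => block_avg Q G (set_block q x v))
  (dep _ _ dF) (dep _ _ dG).
have H : (forall i, K i -> A i || B i) -> (exists2 i, K i & A i) ->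
    (exists2 i, K i & B i) -> c q.1 <= r.
  move=> h1 [i1 Ki1 /asboolP Ai1] [i2 Ki2 /asboolP Bi2]; apply: split_r.
  - move=> s sm; have := h1 (Ordinal (leq_trans sm mqM)) sm.
    by case/orP => /asboolP; [left|right].
  - by exists i1.
  - by exists i2.
move=> /(_ H) {H} key.
have w0 x : 0 <= block_weight q.1 x by apply: block_weight_ge0.
set Fx := fun x => block_avg Q F (set_block q x v) in key *.
set Gx := fun x => block_avg Q G (set_block q x v) in key *.
have sumIH : \sum_(x : T) block_weight q.1 x *
    (2 * (block_avg Q (fun v => F v * G v) (set_block q x v) - Fx x * Gx x)) <=
  \sum_(x : T) block_weight q.1 x *
    (r * ((block_avg Q (fun v => F v ^+ 2) (set_block q x v) - Fx x ^+ 2) +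
       (block_avg Q (fun v => G v ^+ 2) (set_block q x v) - Gx x ^+ 2))).
  by apply: ler_sum => x _; rewrite ler_wpM2l//; exact: IH.
move: key; rewrite -/(block_weight _ _).
have e1 : \sum_x block_weight q.1 x *
    (2 * (block_avg Q (fun v => F v * G v) (set_block q x v) - Fx x * Gx x)) =
    2 * (\sum_x block_weight q.1 x * block_avg Q (fun v => F v * G v) (set_block q x v)
         - \sum_x block_weight q.1 x * (Fx x * Gx x)).
  by rewrite -sumrB mulr_sumr; apply: eq_bigr => x _; ring.
have e2 : \sum_(x : T) block_weight q.1 x *
    (r * ((block_avg Q (fun v => F v ^+ 2) (set_block q x v) - Fx x ^+ 2) +
       (block_avg Q (fun v => G v ^+ 2) (set_block q x v) - Gx x ^+ 2))) =
    r * ((\sum_x block_weight q.1 x * block_avg Q (fun v => F v ^+ 2) (set_block q x v)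
         - \sum_x block_weight q.1 x * (Fx x ^+ 2)) +
        (\sum_x block_weight q.1 x * block_avg Q (fun v => G v ^+ 2) (set_block q x v)
         - \sum_x block_weight q.1 x * (Gx x ^+ 2))).
  by rewrite -!sumrB -big_split/= mulr_sumr; apply: eq_bigr => x _; ring.
rewrite e1 e2 in sumIH => key.
apply: le_trans (le_trans (lerD sumIH key) _); rewrite le_eqVlt; apply/orP; left; apply/eqP;
  rewrite /block_weight; ring.
Qed.

End block_average.

(** * Square-integrable functions *)

Section real_covariance.
Variables (R : realType) (d : measure_display) (T : measurableType d) (P : probability T R).
Implicit Types f g h : T -> R.

Let Pfin : P setT \is a fin_num := fin_num_measure P _ measurableT.

Definition cov f g : R := fine (covariance P f g).

Lemma L2_L1 f : f \in Lfun P 2%:E -> f \in Lfun P 1.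
Proof. exact: Lfun_subset12. Qed.

Lemma cov_fin f g : f \in Lfun P 2%:E -> g \in Lfun P 2%:E ->
  covariance P f g \is a fin_num.
Proof.
move=> f2 g2; apply: covariance_fin_num; [exact: L2_L1|exact: L2_L1|].
exact: Lfun2_mul_Lfun1.
Qed.

Lemma covC f g : cov f g = cov g f.
Proof. by rewrite /cov covarianceC. Qed.

Lemma covDl f g h : f \in Lfun P 2%:E -> g \in Lfun P 2%:E -> h \in Lfun P 2%:E ->
  cov (f \+ g) h = cov f h + cov g h.
Proof. by move=> f2 g2 h2; rewrite /cov covarianceDl// fineD// cov_fin. Qed.

Lemma covBl f g h : f \in Lfun P 2%:E -> g \in Lfun P 2%:E -> h \in Lfun P 2%:E ->
  cov (f \- g) h = cov f h - cov g h.
Proof.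
by move=> f2 g2 h2; rewrite /cov covarianceBl// fineB// cov_fin.
Qed.

Lemma L2B f g : f \in Lfun P 2%:E -> g \in Lfun P 2%:E -> f \- g \in Lfun P 2%:E.
Proof.
move=> f2 g2; have e2 : (1 <= 2%:E :> \bar R)%E by rewrite lee1n.
exact: (@rpredB _ (Lfun P 2%:E)).
Qed.

Lemma L2D f g : f \in Lfun P 2%:E -> g \in Lfun P 2%:E -> f \+ g \in Lfun P 2%:E.
Proof.
move=> f2 g2; have e2 : (1 <= 2%:E :> \bar R)%E by rewrite lee1n.
exact: (@rpredD _ (Lfun P 2%:E)).
Qed.

Lemma L2Z a f : f \in Lfun P 2%:E -> a \o* f \in Lfun P 2%:E.
Proof. by move=> f2; rewrite Lfun_scale// ler1n. Qed.

Lemma covZl a f g : f \in Lfun P 2%:E -> g \in Lfun P 2%:E ->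
  cov (a \o* f) g = a * cov f g.
Proof.
move=> f2 g2; rewrite /cov covarianceZl; [|exact: L2_L1|exact: L2_L1|exact: Lfun2_mul_Lfun1].
by rewrite fineM// cov_fin.
Qed.

Lemma cov_ge0 f : 0 <= cov f f.
Proof. by rewrite /cov fine_ge0// -[covariance P f f]/('V_P[f]) variance_ge0. Qed.

Definition sd f : R := Num.sqrt (cov f f).

Lemma sd_ge0 f : 0 <= sd f. Proof. exact: sqrtr_ge0. Qed.

Lemma sd_sqr f : sd f ^+ 2 = cov f f. Proof. by rewrite sqr_sqrtr ?cov_ge0. Qed.

Lemma cov_sd f g : f \in Lfun P 2%:E -> g \in Lfun P 2%:E -> `|cov f g| <= sd f * sd g.
Proof.
have key f' g' : f' \in Lfun P 2%:E -> g' \in Lfun P 2%:E -> cov f' g' <= sd f' * sd g'.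
  move=> f2 g2; rewrite -lee_fin EFinM /cov fineK ?cov_fin//.
  have := covariance_le f2 g2.
  rewrite -(fineK (variance_fin_num f2)) -(fineK (variance_fin_num g2)).
  by [].
move=> f2 g2; rewrite ler_norml key// andbT lerNl.
have sdN : sd ((-1) \o* f) = sd f.
  by rewrite /sd covZl ?L2Z// (covC f) covZl// !mulN1r opprK.
by have := key ((-1) \o* f) g (L2Z _ f2) g2; rewrite sdN covZl// mulN1r.
Qed.

Lemma sdD f g : f \in Lfun P 2%:E -> g \in Lfun P 2%:E -> sd (f \+ g) <= sd f + sd g.
Proof.
move=> f2 g2; rewrite -(@ler_pXn2r _ 2) ?nnegrE ?addr_ge0 ?sd_ge0//.
rewrite sqrrD !sd_sqr covDl ?L2D// (covC f) covDl ?L2D// (covC g (f \+ g)) covDl ?L2D//.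
have := cov_sd f2 g2; rewrite ler_norml => /andP[_]; rewrite (covC g f); lra.
Qed.

Lemma sd_sub f g : f \in Lfun P 2%:E -> g \in Lfun P 2%:E -> sd (f \- g) = sd (g \- f).
Proof.
move=> f2 g2; rewrite /sd; congr Num.sqrt.
by rewrite !(covBl, covC _ (_ \- _)) ?L2B//; ring.
Qed.

Lemma cov_bound_limit r f g : f \in Lfun P 2%:E -> g \in Lfun P 2%:E -> 0 <= r ->
  (forall e, 0 < e -> e <= 1 -> exists f' g', [/\ f' \in Lfun P 2%:E, g' \in Lfun P 2%:E,
     sd (f \- f') <= e, sd (g \- g') <= e & `|cov f' g'| <= r * (sd f' * sd g')]) ->
  `|cov f g| <= r * (sd f * sd g).
Proof.
move=> f2 g2 r0 H.
(* For an approximation error [e' <= 1] in each function the total error is at most [e' * C]. *)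
pose C := r * (sd f + sd g + 1) + (sd g + sd f + 1).
have C0 : 0 < C.
  have := sd_ge0 f; have := sd_ge0 g => sg sf.
  by rewrite /C ltr_wpDl ?mulr_ge0 ?addr_ge0// ltr_wpDl// addr_ge0.
apply/ler_addgt0Pr => e e0.
pose e' := Num.min 1 (e / C).
have e'0 : 0 < e' by rewrite lt_min ltr01 divr_gt0.
have e'1 : e' <= 1 by rewrite ge_min lexx.
have e'C : e' * C <= e by rewrite -ler_pdivlMr// ge_min lexx orbT.
have [f' [g' [f'2 g'2 ff' gg' fg']]] := H _ e'0 e'1.
have sf' : sd f' <= sd f + e'.
  have -> : f' = f \+ (f' \- f) by apply/funext => x /=; rewrite addrC subrK.
  apply: le_trans (sdD _ _) _; rewrite ?L2B// lerD2l.
  by rewrite sd_sub.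
have sg' : sd g' <= sd g + e'.
  have -> : g' = g \+ (g' \- g) by apply/funext => x /=; rewrite addrC subrK.
  apply: le_trans (sdD _ _) _; rewrite ?L2B// lerD2l.
  by rewrite sd_sub.
have dec : cov f g = cov f' g' + (cov (f \- f') g + cov f' (g \- g')).
  by rewrite covBl// (covC f' (_ \- _)) covBl// (covC g f') (covC g' f'); ring.
have h1 : `|cov (f \- f') g| <= e' * sd g.
  apply: le_trans (cov_sd _ _) _; rewrite ?L2B//.
  by rewrite ler_wpM2r// sd_ge0.
have h2 : `|cov f' (g \- g')| <= (sd f + e') * e'.
  apply: le_trans (cov_sd _ _) _; rewrite ?L2B//.
  by rewrite ler_pM ?sd_ge0.
have h3 : r * (sd f' * sd g') <= r * ((sd f + e') * (sd g + e')).
  by rewrite ler_wpM2l// ler_pM ?sd_ge0.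
rewrite dec; apply: le_trans (ler_normD _ _) _.
apply: le_trans (lerD (le_trans fg' h3) (le_trans (ler_normD _ _) (lerD h1 h2))) _.
apply: le_trans (_ : _ <= r * (sd f * sd g) + e' * C) _; last by rewrite lerD2l.
rewrite -subr_ge0 /C (_ : _ - _ = r * (e' * (1 - e')) + e' * (1 - e')); last by ring.
by rewrite addr_ge0 ?mulr_ge0 ?subr_ge0// ltW.
Qed.

Lemma corr_bound r f g : 0 <= r -> f \in Lfun P 2%:E -> g \in Lfun P 2%:E ->
  `|cov f g| <= r * (sd f * sd g) -> `|corr P f g| <= r.
Proof.
move=> r0 f2 g2 H; rewrite /corr -[fine 'V_P[f]]/(cov f f) -[fine 'V_P[g]]/(cov g g).
rewrite -[fine _]/(cov f g) sqrtrM ?cov_ge0// -/(sd f) -/(sd g).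
have := mulr_ge0 (sd_ge0 f) (sd_ge0 g); rewrite le_eqVlt => /orP[/eqP <-|fg0].
  by rewrite invr0 mulr0 normr0.
by rewrite normrM normfV (gtr0_norm fg0) ler_pdivrMr.
Qed.

Lemma corr_le1 f g : f \in Lfun P 2%:E -> g \in Lfun P 2%:E -> `|corr P f g| <= 1.
Proof. by move=> f2 g2; apply: corr_bound => //; rewrite mul1r cov_sd. Qed.

Lemma sd_le f (e : R) : f \in Lfun P 2%:E -> 0 <= e ->
  ('E_P[(fun x => f x ^+ 2)%R] <= (e ^+ 2)%:E)%E -> sd f <= e.
Proof.
move=> f2 e0 H; rewrite -(@ler_pXn2r _ 2) ?nnegrE ?sd_ge0// sd_sqr -lee_fin.
apply: le_trans H; rewrite /cov fineK ?cov_fin// -[covariance P f f]/('V_P[f]) varianceE//.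
rewrite (_ : (f ^+ 2) = (fun x => f x ^+ 2)); last by apply/funext.
rewrite -[leRHS]adde0; apply: leeD2l.
by rewrite oppe_le0 sqre_ge0.
Qed.

Lemma L2_bounded f (a : R) : measurable_fun setT f -> (forall x, `|f x| <= a) ->
  f \in Lfun P 2%:E.
Proof.
move=> mf fa; have a0 : 0 <= a by apply: le_trans (fa point).
rewrite inE; apply/andP; split; rewrite inE//=.
rewrite /finite_norm unlock poweR_lty//.
apply: (@le_lt_trans _ _ (\int[P]_x (a `^ 2)%:E)%E).
  apply: ge0_le_integral => //.
  - by move=> x _; rewrite lee_fin powR_ge0.
  - apply/measurable_EFinP/(measurableT_comp (measurable_powR _)) => //.
    exact: measurableT_comp.
  - by move=> x _; rewrite lee_fin ge0_ler_powR// nnegrE.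
apply/integrable_lty => //; exact: finite_measure_integrable_cst.
Qed.

End real_covariance.

(** * Functions of finitely many bits *)

Section finite_functions.
Variables (R : realType) (dim : nat) (m : nat -> nat) (c : nat -> R).
Variable mu : probability (bitspace (site dim)) R.
Hypotheses (m_gt0 : forall b, (0 < m b)%N) (c01 : forall b, 0 <= c b <= 1).
Hypothesis mu_blocks : forall M (Q : seq (nat * Zd dim)) (x : nat * Zd dim -> nat -> bool),
  uniq Q -> (forall q, q \in Q -> (m q.1 <= M)%N) ->
  mu [set v | forall q s, q \in Q -> (s < M)%N -> v (q, s) = x q s] =
  (\prod_(q <- Q) (2 ^- M * (1 + c q.1 * \prod_(s < m q.1) (-1) ^+ x q s)))%:E.

Local Notation I := (site dim).
Local Notation config := (bitspace I).
Implicit Types (S : set I) (Q : seq (nat * Zd dim)).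

Let window Q M : set I := [set t | t.1 \in Q /\ (t.2 < M)%N].

Let block_event M Q (x : nat * Zd dim -> nat -> bool) : set config :=
  [set v | forall q s, q \in Q -> (s < M)%N -> v (q, s) = x q s].

Let measurable_block_event M Q x : measurable (block_event M Q x).
Proof.
rewrite (_ : block_event M Q x = [set v : config | all (fun t => v t == x t.1 t.2)
    [seq (q, s) | q <- Q, s <- iota 0 M]]); first exact: measurable_all_bits.
apply/seteqP; split => v /= h.
  by apply/allP => t /allpairsP[[q s] [/= qQ]]; rewrite mem_iota/= => sM ->; apply/eqP; exact: h.
move=> q s qQ sM; apply/eqP; move/allP : h => /(_ (q, s)); apply.
by apply/allpairsP; exists (q, s); rewrite mem_iota.
Qed.

Lemma expectation_finite_sum (A : finType) (f : A -> config -> R) :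
  (forall a, f a \in Lfun mu 1) ->
  (\sum_(a : A) f a) \in Lfun mu 1 /\ ('E_mu[\sum_(a : A) f a])%E = (\sum_(a : A) 'E_mu[f a])%E.
Proof.
move=> f1; split; first by apply: rpred_sum => a _; exact: f1.
have := @expectation_sum _ _ _ mu [seq f a | a <- index_enum A].
rewrite !big_map; apply => _ /mapP[a _ ->]; exact: f1.
Qed.

(** Blocks move one by one from [Q], where they are averaged, to [Q0], where their values are
    prescribed; each move splits the event according to the values of the moved block. Once [Q] is
    empty, [F] is constant. *)
Let avg_event M Q Q0 x0 F v0 : uniq (Q ++ Q0) ->
  (forall q, q \in Q ++ Q0 -> (m q.1 <= M)%N) ->
  depends_on (window Q M) F ->
  (\1_(block_event M Q0 x0) \* F : config -> R) \in Lfun mu 1 /\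
  ('E_mu[(\1_(block_event M Q0 x0) \* F : config -> R)])%E =
    (fine (mu (block_event M Q0 x0)) * block_avg m c M Q F v0)%:E.
Proof.
elim: Q Q0 x0 F v0 => [|q Q IH] Q0 x0 F v0 uQ mQ dF.
  have L1 : (\1_(block_event M Q0 x0) : config -> R) \in Lfun mu 1.
    by apply/Lfun1_integrable; apply: integrable_indic.
  have -> : (\1_(block_event M Q0 x0) \* F : config -> R) =
      F v0 \o* \1_(block_event M Q0 x0).
    by apply/funext => v /=; rewrite (dF v v0)// => t [].
  split; first by rewrite Lfun_scale.
  rewrite expectationZl// expectation_indic// [block_avg _ _ _ _ _ _]/=.
  by rewrite mulrC EFinM fineK// fin_num_measure.
pose x1 (x : {ffun 'I_M -> bool}) (q' : nat * Zd dim) s :=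
  if q' == q then (if insub s is Some i then x i else true) else x0 q' s.
pose F1 (x : {ffun 'I_M -> bool}) v := F (set_block q x v).
have [/= qQ0 uQ'] : q \notin Q0 /\ uniq (Q ++ q :: Q0).
  move: uQ; rewrite /= mem_cat negb_or => /andP[/andP[qQ qQ0] uQ]; split => //.
  by rewrite -cat1s uniq_catCA/= uQ andbT mem_cat negb_or qQ qQ0.
have mQ' q' : q' \in Q ++ q :: Q0 -> (m q'.1 <= M)%N.
  by move=> h; apply: mQ; move: h; rewrite !(inE, mem_cat) orbCA.
have dF1 x : depends_on (window Q M) (F1 x).
  move=> v w vw; apply: dF => -[q' s] [/=]; rewrite inE => h sM.
  rewrite /set_block/=; case: eqP h => /= [_ _|_ h]; last exact: vw.
  by rewrite insubT.
have IHx x := IH (q :: Q0) (x1 x) (F1 x) v0 uQ' mQ' (dF1 x).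
have -> : (\1_(block_event M Q0 x0) \* F : config -> R) =
    \sum_(x : {ffun 'I_M -> bool}) (\1_(block_event M (q :: Q0) (x1 x)) \* F1 x).
  apply/funext => v; rewrite fct_sumE /=.
  have [vH|vH] := pselect (block_event M Q0 x0 v); last first.
    rewrite indicE memNset// mul0r big1// => x _; rewrite indicE memNset ?mul0r//.
    move=> h; apply: vH => q' s q'Q0 sM; rewrite h ?inE ?q'Q0 ?orbT//.
    by rewrite /x1; case: eqP => // qq'; rewrite -qq' q'Q0 in qQ0.
  pose xv : {ffun 'I_M -> bool} := [ffun i => v (q, nat_of_ord i)].
  rewrite (bigD1 xv)//= [X in _ = _ + X]big1 => [|x xxv].
    rewrite addr0 !indicE !mem_set ?mul1r//.
      congr F; apply/funext => -[q' s]; rewrite /set_block/=; case: eqP => // ->.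
      by case: insubP => // i _ <-; rewrite ffunE.
    move=> q' s; rewrite inE /x1; case: eqP => [-> _ sM|_ /= ]; last exact: vH.
    by rewrite insubT ffunE.
  rewrite indicE memNset ?mul0r// => h; apply: (negP xxv); apply/eqP/ffunP => i.
  rewrite ffunE h ?inE ?eqxx// /x1 eqxx; case: insubP => [j _ ji|]; last by rewrite ltn_ord.
  by congr (x _); apply: val_inj.
have [S1 ->] := expectation_finite_sum (fun x => (IHx x).1).
split => //.
rewrite (eq_bigr _ (fun x _ => (IHx x).2)) sumEFin; congr EFin; rewrite mulr_sumr.
apply: eq_bigr => x _; rewrite (@block_avg_set_block _ _ _ _ _ Q q x F); last first.
  by move: uQ => /= /andP[]; rewrite mem_cat negb_or => /andP[].
rewrite mulrA; congr (_ * _).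
have uQ0 : uniq Q0 by move: uQ'; rewrite cat_uniq => /and3P[_ _ /andP[]].
rewrite /block_event !mu_blocks//=; last 3 first.
- by move=> q' q'Q0; apply: mQ'; rewrite mem_cat inE q'Q0 !orbT.
- by rewrite qQ0.
- by move=> q' q'Q0; apply: mQ'; rewrite mem_cat q'Q0 !orbT.
rewrite big_cons mulrC; congr (_ * _).
  apply: eq_big_seq => q' q'Q0; have /negbTE nq : q' != q.
    by apply: contraNneq qQ0 => <-.
  by congr (_ * (1 + _ * _)); apply: eq_bigr => s _; rewrite /x1 nq.
have mqM : (m q.1 <= M)%N by apply: mQ; rewrite inE eqxx.
rewrite /block_weight (big_ord_widen _ (fun s => (-1) ^+ x1 x q s) mqM).
congr (_ * (1 + _ * _)); apply: eq_bigr => s _; rewrite /x1 eqxx.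
by case: insubP => [j _ js|]; [congr (_ ^+ x _); exact: val_inj|rewrite ltn_ord].
Qed.

Lemma expectation_block_avg M Q F v0 : uniq Q -> (forall q, q \in Q -> (m q.1 <= M)%N) ->
  depends_on [set t | t.1 \in Q /\ (t.2 < M)%N] F ->
  F \in Lfun mu 1 /\ ('E_mu[F])%E = (block_avg m c M Q F v0)%:E.
Proof.
move=> uQ mQ dF; have := @avg_event M Q [::] (fun _ _ => true) F v0.
rewrite cats0 => /(_ uQ mQ dF).
have -> : block_event M [::] (fun _ _ => true) = setT by apply/seteqP; split.
have -> : (\1_setT \* F : config -> R) = F.
  by apply/funext => v /=; rewrite indicE mem_set// mul1r.
by rewrite probability_setT/= mul1r.
Qed.

(** [M] has to reach past the end of every block in [Q], because [mu_blocks] gives the law of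
    complete blocks only. *)
Definition finite_dep (U : Type) S (F : config -> U) := exists Q M,
  [/\ uniq Q, forall q, q \in Q -> (m q.1 <= M)%N &
      depends_on [set t | S t /\ (t.1 \in Q /\ (t.2 < M)%N)] F].

Lemma finite_dep_common (U V : Type) S S' (F : config -> U) (G : config -> V) :
  finite_dep S F -> finite_dep S' G -> exists Q M,
  [/\ uniq Q, forall q, q \in Q -> (m q.1 <= M)%N,
      depends_on [set t | S t /\ (t.1 \in Q /\ (t.2 < M)%N)] F &
      depends_on [set t | S' t /\ (t.1 \in Q /\ (t.2 < M)%N)] G].
Proof.
move=> [Q [M [uQ mQ dF]]] [Q' [M' [uQ' mQ' dG]]].
exists (undup (Q ++ Q')), (maxn M M'); split => //; first exact: undup_uniq.
- move=> q; rewrite mem_undup mem_cat leq_max => /orP[/mQ ->//|/mQ' ->]; exact: orbT.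
- move=> v w vw; apply: dF => t [St [tQ tM]]; apply: vw; split=> //.
  by rewrite mem_undup mem_cat tQ leq_max tM.
- move=> v w vw; apply: dG => t [St [tQ tM]]; apply: vw; split=> //.
  by rewrite mem_undup mem_cat tQ leq_max tM !orbT.
Qed.

Lemma finite_dep_comp (U V : Type) S (op : U -> V) (F : config -> U) :
  finite_dep S F -> finite_dep S (fun v => op (F v)).
Proof.
by move=> [Q [M [uQ mQ dF]]]; exists Q, M; split => // v w /dF ->.
Qed.

Lemma finite_dep_op (U V W : Type) S (op : U -> V -> W) (F : config -> U) (G : config -> V) :
  finite_dep S F -> finite_dep S G -> finite_dep S (fun v => op (F v) (G v)).
Proof.
move=> dF dG; have [Q [M [uQ mQ dF' dG']]] := finite_dep_common dF dG.
by exists Q, M; split => // v w vw; rewrite (dF' _ _ vw) (dG' _ _ vw).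
Qed.

Lemma finite_dep_seq (U : Type) S (ts : seq I) (F : config -> U) :
  (forall t, t \in ts -> S t) -> depends_on [set t | t \in ts] F -> finite_dep S F.
Proof.
move=> tsS dF; pose M := (\max_(t <- ts) maxn t.2.+1 (m t.1.1))%N.
have tM t : t \in ts -> (maxn t.2.+1 (m t.1.1) <= M)%N.
  by move=> tts; rewrite /M (big_rem t)//= leq_maxl.
exists (undup (map fst ts)), M; split; first exact: undup_uniq.
  move=> q; rewrite mem_undup => /mapP[t tts ->].
  by apply: leq_trans (tM t tts); rewrite leq_maxr.
move=> v w vw; apply: dF => t tts; apply: vw; split; first exact: tsS.
split; first by rewrite mem_undup map_f.
by apply: leq_trans (tM t tts); rewrite leq_maxl.
Qed.

Lemma finite_dep_L1 S (F : config -> R) : finite_dep S F -> F \in Lfun mu 1.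
Proof.
move=> [Q [M [uQ mQ dF]]].
have dF' : depends_on [set t | t.1 \in Q /\ (t.2 < M)%N] F.
  by move=> v w vw; apply: dF => t [_]; exact: vw.
by have [] := expectation_block_avg point uQ mQ dF'.
Qed.

Lemma finite_dep_measurable S (F : config -> R) : finite_dep S F -> measurable_fun setT F.
Proof. by move/finite_dep_L1; rewrite inE => /andP[]; rewrite inE. Qed.

Lemma L2_of_sqr d (T : measurableType d) (P : probability T R) (f : T -> R) :
  measurable_fun setT f -> (fun x => f x ^+ 2) \in Lfun P 1 -> f \in Lfun P 2%:E.
Proof.
move=> mf /Lfun1_integrable f2.
rewrite inE; apply/andP; split; rewrite inE//=.
rewrite /finite_norm unlock poweR_lty//.
have /integrableP[_] := f2.
rewrite (_ : (\int[P]_x _)%E = (\int[P]_x (`|(EFin \o f) x| `^ 2))%E)//.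
apply: eq_integral => x _ /=; congr EFin.
by rewrite powR_mulrn// ger0_norm ?sqr_ge0// real_normK ?num_real.
Qed.

Lemma finite_dep_L2 S (F : config -> R) : finite_dep S F -> F \in Lfun mu 2%:E.
Proof.
move=> dF; apply: L2_of_sqr; first exact: finite_dep_measurable dF.
exact: (finite_dep_L1 (finite_dep_comp (fun x : R => x ^+ 2) dF)).
Qed.

Lemma finite_dep_cov S S' r F G : 0 <= r -> (forall t, S t -> S' t -> False) ->
  (forall q, (forall s, (s < m q.1)%N -> S (q, s) \/ S' (q, s)) ->
     (exists2 s, (s < m q.1)%N & S (q, s)) -> (exists2 s, (s < m q.1)%N & S' (q, s)) ->
     c q.1 <= r) ->
  finite_dep S F -> finite_dep S' G -> `|cov mu F G| <= r * (sd mu F * sd mu G).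
Proof.
move=> r0 SS' split_r.
have half F' G' : finite_dep S F' -> finite_dep S' G' ->
    2 * cov mu F' G' <= r * (cov mu F' F' + cov mu G' G').
  move=> dF dG; have [Q [M [uQ mQ dF' dG']]] := finite_dep_common dF dG.
  have covE (H K : config -> R) : depends_on (window Q M) H -> depends_on (window Q M) K ->
      cov mu H K = block_avg m c M Q (fun v => H v * K v) point -
        block_avg m c M Q H point * block_avg m c M Q K point.
    move=> dH dK.
    have [H1 HE] := expectation_block_avg point uQ mQ dH.
    have [K1 KE] := expectation_block_avg point uQ mQ dK.
    have [HK1 HKE] := @expectation_block_avg M Q (fun v => H v * K v) point uQ mQ
      (fun v w vw => congr2 _ (dH v w vw) (dK v w vw)).
    by rewrite /cov covarianceE// HE KE HKE.
  have dFw : depends_on (window Q M) F' by move=> v w vw; apply: dF' => t [_]; exact: vw.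
  have dGw : depends_on (window Q M) G' by move=> v w vw; apply: dG' => t [_]; exact: vw.
  rewrite !covE//.
  by apply: (@block_avg_covariance R dim m c M r m_gt0 c01 r0 _ _ Q F' G' point
    (fun t (h : _ /\ _) (h' : _ /\ _) => SS' t h.1 h'.1) dF' dG' mQ) => q h1 h2 h3;
    apply: split_r; [move=> s /h1 [[? _]|[? _]]; [left|right]|
      case: h2 => s ? [? _]; exists s|case: h3 => s ? [? _]; exists s].
move=> dF dG.
have F2 := finite_dep_L2 dF; have G2 := finite_dep_L2 dG.
(* Homogenisation: for [s = sd G] and [t] equal to [sd F] or its opposite, both variance terms
   become the square of [sd F * sd G], and the additive bound becomes the multiplicative one. *)
have scaled s t : 2 * (s * t) * cov mu F G <= r * (s ^+ 2 * cov mu F F + t ^+ 2 * cov mu G G).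
  have := half (s \o* F) (t \o* G) (finite_dep_comp (fun x => x * s) dF)
    (finite_dep_comp (fun x => x * t) dG).
  rewrite !covZl ?L2Z// !(covC mu _ (_ \o* _)) !covZl// (covC mu G F).
  by rewrite !expr2 !mulrA; congr (_ <= _); ring.
have := sd_ge0 mu F; rewrite le_eqVlt => /orP[/eqP F0|F0].
  by rewrite -F0 mul0r mulr0; apply: le_trans (cov_sd F2 G2) _; rewrite -F0 mul0r.
have := sd_ge0 mu G; rewrite le_eqVlt => /orP[/eqP G0|G0].
  by rewrite -G0 mulr0 mulr0; apply: le_trans (cov_sd F2 G2) _; rewrite -G0 mulr0.
have FG0 : 0 < 2 * (sd mu F * sd mu G) by rewrite !mulr_gt0.
rewrite ler_norml -lerN2 opprK; apply/andP; split; rewrite -(ler_pM2l FG0).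
- by have := scaled (sd mu G) (- sd mu F); rewrite sqrrN -!(sd_sqr mu); lra.
- by have := scaled (sd mu G) (sd mu F); rewrite -!(sd_sqr mu); lra.
Qed.

End finite_functions.

Definition symdiff (T : Type) (A B : set T) := (A `\` B) `|` (B `\` A).

Lemma measurable_symdiff d (T : measurableType d) (A B : set T) :
  measurable A -> measurable B -> measurable (symdiff A B).
Proof. by move=> mA mB; apply: measurableU; exact: measurableD. Qed.

Definition step_function (R : realType) (h : R -> R) :=
  exists n (a : 'I_n -> R) (B : 'I_n -> set R),
  (forall i, measurable (B i)) /\ h = fun x => \sum_(i < n) a i * \1_(B i) x.

Section positive_part_approximation.
Variable R : realType.
Import HBNNSimple.

(** Applied with [s = 1] and [s = -1], that is, to the positive and negative parts: simple functions
    approximate nonnegative functions from below. *)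
Lemma step_approximation (s : R) : exists h : nat -> R -> R,
  [/\ forall n, step_function (h n), forall n, measurable_fun setT (h n),
      forall n x, 0 <= h n x <= Num.max (s * x) 0 &
      forall x, h n x @[n --> \oo] --> Num.max (s * x) 0].
Proof.
pose g (x : R) := (Num.max (s * x) 0)%:E.
have mg : measurable_fun setT g.
  apply/measurable_EFinP; apply: measurable_maxr => //.
pose h := nnsfun_approx measurableT mg.
have cvgh x : h n x @[n --> \oo] --> Num.max (s * x) 0.
  have g0 y : setT y -> (0 <= g y)%E by rewrite /g lee_fin le_max lexx orbT.
  by have /fine_cvgP[_] := cvg_nnsfun_approx measurableT mg g0 (Logic.I : setT x).
have ndh x : nondecreasing_seq (fun n => h n x).
  by move=> i j ij; have /lefP := nd_nnsfun_approx measurableT mg ij; apply.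
exists (fun n => h n); split => //.
- move=> n; pose t : seq R := finmap.enum_fset (fset_set (h n @` setT)).
  exists (size t), (fun i => t`_i), (fun i => h n @^-1` [set t`_i]); split.
    by move=> i; exact: measurable_funPTI.
  by apply/funext => x; rewrite fimfunEord.
- move=> n x; rewrite fun_ge0/=.
  have <- : limn (fun n => h n x) = Num.max (s * x) 0 by apply/cvg_lim.
  apply: nondecreasing_cvgn_le => //.
  by apply/cvg_ex; exists (Num.max (s * x) 0).
Qed.

End positive_part_approximation.

(** * Density of functions of finitely many bits *)

Section approximation.
Variables (R : realType) (dim : nat) (m : nat -> nat) (c : nat -> R).
Variable mu : probability (bitspace (site dim)) R.
Hypotheses (m_gt0 : forall b, (0 < m b)%N).
Hypothesis mu_blocks : forall M (Q : seq (nat * Zd dim)) (x : nat * Zd dim -> nat -> bool),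
  uniq Q -> (forall q, q \in Q -> (m q.1 <= M)%N) ->
  mu [set v | forall q s, q \in Q -> (s < M)%N -> v (q, s) = x q s] =
  (\prod_(q <- Q) (2 ^- M * (1 + c q.1 * \prod_(s < m q.1) (-1) ^+ x q s)))%:E.
Variable S : set (site dim).

Local Notation I := (site dim).
Local Notation config := (bitspace I).

(** These sets form a sigma-algebra, which carries the property from single bits to all of
    [gen_sigma]. The approximating event may read only bits in [S], so the approximants for two
    disjoint sides still read disjoint bits. *)
Definition approx_set (A : set config) := measurable A /\
  forall e : R, 0 < e -> exists A' : set config,
    [/\ measurable A', finite_dep m S (A' : config -> Prop) & (mu (symdiff A A') <= e%:E)%E].

Lemma finite_dep_set_measurable (A : set config) :
  finite_dep m S (A : config -> Prop) -> measurable A.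
Proof.
move=> dA; have dI : finite_dep m S (\1_A : config -> R).
  have -> : (\1_A : config -> R) = (fun v => if `[< A v >] then 1 else 0).
    apply/funext => v; rewrite indicE; case: asboolP => h; first by rewrite mem_set.
    by rewrite memNset.
  exact: (finite_dep_comp (fun p : Prop => if `[< p >] then 1 else 0) dA).
have := finite_dep_measurable mu_blocks dI => mI.
rewrite (_ : A = (\1_A : config -> R) @^-1` [set 1]).
  by rewrite -[X in measurable X]setTI; exact: mI.
apply/seteqP; split => v /=; rewrite /preimage/= indicE.
  by move=> Av; rewrite mem_set.
by have [/set_mem//|_ /eqP] := boolP (v \in A); rewrite eq_sym oner_eq0.
Qed.

Lemma approx_set_finite (A : set config) : finite_dep m S (A : config -> Prop) -> approx_set A.
Proof.
move=> dA; have mA := finite_dep_set_measurable dA.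
split=> // e e0; exists A; split=> //.
by rewrite /symdiff setDv setU0 measure0 lee_fin ltW.
Qed.

Lemma approx_setC A : approx_set A -> approx_set (~` A).
Proof.
move=> [mA hA]; split; first exact: measurableC.
move=> e /hA[A' [mA' dA' AA']]; exists (~` A'); split; first exact: measurableC.
  exact: (finite_dep_comp not dA').
by rewrite /symdiff !setDE !setCK setUC (setIC _ A') (setIC _ A) -!setDE.
Qed.

Lemma approx_setU A B : approx_set A -> approx_set B -> approx_set (A `|` B).
Proof.
move=> [mA hA] [mB hB]; split; first exact: measurableU.
move=> e e0; have e2 : 0 < e / 2 by rewrite divr_gt0.
have [A' [mA' dA' AA']] := hA _ e2; have [B' [mB' dB' BB']] := hB _ e2.
exists (A' `|` B'); split; first exact: measurableU.
  exact: (finite_dep_op or dA' dB').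
apply: (@le_trans _ _ (mu (symdiff A A' `|` symdiff B B'))).
  apply: le_measure; rewrite ?inE.
  - by apply: measurable_symdiff; exact: measurableU.
  - by apply: measurableU; exact: measurable_symdiff.
  - move=> v; rewrite /symdiff/=; tauto.
apply: le_trans (measureU2 _ _ _) _; [exact: measurable_symdiff|exact: measurable_symdiff|].
by rewrite [leRHS](_ : _ = (e / 2)%:E + (e / 2)%:E)%E ?leeD// -EFinD -splitr.
Qed.

(** By continuity from below a finite partial union misses at most [e / 2], and it can itself be
    approximated within [e / 2]. *)
Lemma approx_set_bigcup (F : (set config)^nat) :
  (forall i, approx_set (F i)) -> approx_set (\bigcup_i F i).
Proof.
move=> hF; have mF i := (hF i).1.
have mA : measurable (\bigcup_i F i) by exact: bigcupT_measurable.
split=> // e e0; have e2 : 0 < e / 2 by rewrite divr_gt0.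
pose U n := \big[setU/set0]_(i < n) F i.
have hU n : approx_set (U n).
  elim: n => [|n IH]; last by rewrite /U big_ord_recr/=; exact: approx_setU.
  rewrite /U big_ord0; apply: approx_set_finite.
  by exists [::], 0%N; split.
have mU n := (hU n).1.
have UA n : U n `<=` \bigcup_i F i.
  by rewrite /U -bigcup_mkord; move=> v [i _ Fi]; exists i.
have [n Hn] : exists n, (mu ((\bigcup_i F i) `\` U n) <= (e / 2)%:E)%E.
  have cvgU : mu \o U @ \oo --> mu (\bigcup_n U n).
    apply: nondecreasing_cvg_mu => //; first exact: bigcupT_measurable.
    move=> i j ij; apply/subsetPset; rewrite /U -!bigcup_mkord => v [k ki Fk].
    by exists k => //=; exact: leq_trans ij.
  rewrite (_ : \bigcup_n U n = \bigcup_i F i) in cvgU; last first.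
    apply/seteqP; split => v [i _]; first exact: UA.
    by move=> Fi; exists i.+1 => //; rewrite /U big_ord_recr/=; right.
  have fA : mu (\bigcup_i F i) \is a fin_num by exact: fin_num_measure.
  move: cvgU; rewrite -(fineK fA).
  move=> /fine_cvgP[_ /cvgrPdist_le/(_ _ e2)[n _ /(_ n (leqnn n))]] /= H.
  exists n; rewrite measureD//; last by rewrite -ge0_fin_numE.
  rewrite setIidr; last exact: UA.
  have fU : mu (U n) \is a fin_num by exact: fin_num_measure.
  have := le_trans (ler_norm _) H; rewrite -lee_fin EFinB fineK//.
  by rewrite -[X in (_ - X)%E]/((fine (mu (U n)))%:E) fineK.
have [A' [mA' dA' UA']] := (hU n).2 _ e2.
exists A'; split => //.
apply: (@le_trans _ _ (mu (((\bigcup_i F i) `\` U n) `|` symdiff (U n) A'))).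
  apply: le_measure; rewrite ?inE.
  - exact: measurable_symdiff.
  - by apply: measurableU; [exact: measurableD|exact: measurable_symdiff].
  - move=> v; rewrite /symdiff/= => -[[h1 h2]|[h1 h2]].
      by have [hu|hu] := pselect (U n v); [right; left|left].
    by right; right; split => // /UA.
apply: le_trans (measureU2 _ _ _) _; [exact: measurableD|exact: measurable_symdiff|].
by rewrite [leRHS](_ : _ = (e / 2)%:E + (e / 2)%:E)%E ?leeD// -EFinD -splitr.
Qed.

Lemma approx_set_sigma_algebra : sigma_algebra setT approx_set.
Proof.
split.
- by apply: approx_set_finite; exists [::], 0%N; split.
- by move=> A hA; rewrite setTD; exact: approx_setC.
- exact: approx_set_bigcup.
Qed.

Lemma approx_set_bits (f : nat -> I) (C : set (bitspace nat)) :
  (forall i, S (f i)) -> measurable C ->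
  approx_set [set v : config | C (fun i => v (f i))].
Proof.
move=> Sf mC.
have [s0 sD sU] := approx_set_sigma_algebra.
suff H : <<s range (@cyl nat) >> `<=` [set C | approx_set [set v : config | C (fun i => v (f i))]].
  exact: H.
apply: smallest_sub.
  split=> //=.
  - by move=> A hA; have := sD _ hA; congr approx_set; apply/seteqP; split.
  - by move=> F hF; have := sU _ hF; congr approx_set; apply/seteqP; split => v [i _ ?]; exists i.
move=> _ [l _ <-]; apply: approx_set_finite.
apply: (@finite_dep_seq _ _ _ _ [seq f q.1 | q <- l]) => //.
  by move=> t /mapP[q _ ->].
move=> v w vw; rewrite /cyl/=; congr is_true; apply: eq_in_all => q ql.
by rewrite vw//= map_f.
Qed.

Definition approx_fun (f : config -> R) := f \in Lfun mu 2%:E /\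
  forall e : R, 0 < e -> exists f' : config -> R, finite_dep m S f' /\ sd mu (f \- f') <= e.

Lemma approx_fun_indic A : approx_set A -> approx_fun \1_A.
Proof.
move=> [mA hA].
have I2 B : measurable B -> (\1_B : config -> R) \in Lfun mu 2%:E.
  move=> mB; apply: (@L2_bounded _ _ _ _ _ 1) => // v.
  by rewrite indicE ger0_norm//; case: (_ \in _).
split=> [|e e0]; first exact: I2.
have [A' [mA' dA' AA']] := hA (e ^+ 2) (exprn_gt0 2 e0).
exists \1_A'; split.
  have -> : (\1_A' : config -> R) = (fun v => if `[< A' v >] then 1 else 0).
    apply/funext => v; rewrite indicE; case: asboolP => h; first by rewrite mem_set.
    by rewrite memNset.
  exact: (finite_dep_comp (fun p : Prop => if `[< p >] then 1 else 0) dA').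
apply: sd_le; [by apply: L2B; exact: I2|exact: ltW|].
have -> : (fun v : config => (\1_A \- \1_A') v ^+ 2) = (\1_(symdiff A A') : config -> R).
  apply/funext => v; rewrite /= !indicE.
  have [a|a] := boolP (v \in A); have [a'|a'] := boolP (v \in A').
  - by rewrite memNset ?subrr ?expr0n// => -[[_]|[_]]; apply; exact: set_mem.
  - rewrite mem_set ?subr0 ?expr1n//; left; split; first exact: set_mem.
    by move=> h; move: a'; rewrite mem_set.
  - rewrite mem_set ?sub0r ?sqrrN ?expr1n//; right; split; first exact: set_mem.
    by move=> h; move: a; rewrite mem_set.
  - rewrite memNset ?subrr ?expr0n// => -[[h _]|[h _]].
      by move: a; rewrite mem_set.
    by move: a'; rewrite mem_set.
by rewrite expectation_indic//; exact: measurable_symdiff.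
Qed.

Lemma approx_funD f g : approx_fun f -> approx_fun g -> approx_fun (f \+ g).
Proof.
move=> [f2 hf] [g2 hg]; split=> [|e e0]; first exact: L2D.
have e2 : 0 < e / 2 by rewrite divr_gt0.
have [f' [df' ff']] := hf _ e2; have [g' [dg' gg']] := hg _ e2.
exists (f' \+ g'); split; first exact: (finite_dep_op (fun x y => x + y) df' dg').
have f'2 := finite_dep_L2 mu_blocks df'; have g'2 := finite_dep_L2 mu_blocks dg'.
have -> : (f \+ g) \- (f' \+ g') = (f \- f') \+ (g \- g').
  by apply/funext => v /=; rewrite opprD addrACA.
by apply: le_trans (sdD _ _) _; rewrite ?L2B// (splitr e) lerD.
Qed.

Lemma approx_funZ a f : approx_fun f -> approx_fun (a \o* f).
Proof.
move=> [f2 hf]; split=> [|e e0]; first exact: L2Z.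
have a0 : 0 < `|a| + 1 by rewrite ltr_wpDl.
have [f' [df' ff']] := hf (e / (`|a| + 1)) (divr_gt0 e0 a0).
exists (a \o* f'); split; first exact: (finite_dep_comp (fun x => x * a) df').
have f'2 := finite_dep_L2 mu_blocks df'.
have -> : (a \o* f) \- (a \o* f') = a \o* (f \- f').
  by apply/funext => v /=; rewrite mulrBl.
have -> : sd mu (a \o* (f \- f')) = `|a| * sd mu (f \- f').
  rewrite /sd covZl ?L2Z ?L2B// covC covZl ?L2B// mulrA -expr2.
  by rewrite sqrtrM ?sqr_ge0// sqrtr_sqr.
move: ff'; rewrite ler_pdivlMr// => H.
apply: le_trans H; rewrite mulrC ler_wpM2l ?sd_ge0//.
by rewrite lerDl.
Qed.

Lemma approx_fun_sum n (f : 'I_n -> config -> R) : (forall i, approx_fun (f i)) ->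
  approx_fun (fun v => \sum_(i < n) f i v).
Proof.
elim: n f => [|n IH] f hf.
  have -> : (fun v => \sum_(i < 0) f i v) = (0 : R) \o* (\1_set0 : config -> R).
    by apply/funext => v; rewrite big_ord0 /= mulr0.
  apply/approx_funZ/approx_fun_indic; by have [] := approx_set_sigma_algebra.
have -> : (fun v => \sum_(i < n.+1) f i v) =
    (fun v => \sum_(i < n) f (widen_ord (leqnSn n) i) v) \+ f ord_max.
  by apply/funext => v; rewrite big_ord_recr.
by apply: approx_funD => //; apply: IH.
Qed.

Lemma approx_fun_step (f : config -> R) (h : R -> R) : step_function h ->
  (forall B : set R, measurable B -> approx_set (f @^-1` B)) -> approx_fun (h \o f).
Proof.
move=> [n [a [B [mB ->]]]] hf.
have -> : (fun x => \sum_(i < n) a i * \1_(B i) x) \o f =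
    (fun v => \sum_(i < n) (a i \o* \1_(f @^-1` B i)) v).
  by apply/funext => v /=; apply: eq_bigr => i _; rewrite mulrC.
by apply: approx_fun_sum => i; apply/approx_funZ/approx_fun_indic/hf.
Qed.

(** [f] is first replaced by a simple function of [f], whose level sets are preimages under [f] and
    hence approximable. Since the positive and negative parts are approximated from below, the
    squared error is dominated by [f ^+ 2] and dominated convergence applies. *)
Lemma approx_fun_measurable (f : config -> R) : f \in Lfun mu 2%:E ->
  (forall B : set R, measurable B -> approx_set (f @^-1` B)) -> approx_fun f.
Proof.
move=> f2 hf; split=> // e e0.
have e2 : 0 < e / 2 by rewrite divr_gt0.
suff [g [hg fg]] : exists g, approx_fun g /\ sd mu (f \- g) <= e / 2.
  have [g2 /(_ _ e2)[f' [df' gf']]] := hg.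
  have f'2 := finite_dep_L2 mu_blocks df'.
  exists f'; split => //.
  have -> : f \- f' = (f \- g) \+ (g \- f') by apply/funext => v /=; rewrite addrA subrK.
  by apply: le_trans (sdD _ _) _; rewrite ?L2B// (splitr e) lerD.
have mf : measurable_fun setT f by move: f2; rewrite inE => /andP[]; rewrite inE.
have [h [sh mh hle hcvg]] := step_approximation (1 : R).
have [k [sk mk kle kcvg]] := step_approximation (-1 : R).
pose g n := (h n \o f) \+ ((-1) \o* (k n \o f)).
have gE n v : g n v = h n (f v) - k n (f v) by rewrite /g /= mulrN1.
have hg n : approx_fun (g n).
  by apply: approx_funD; [exact: approx_fun_step|apply: approx_funZ; exact: approx_fun_step].
have maxE (x : R) : Num.max (1 * x) 0 - Num.max (-1 * x) 0 = x :> R.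
  rewrite mul1r mulN1r; have [x0|x0] := leP 0 x.
    by rewrite max_r ?oppr_le0// subr0.
  by rewrite max_l ?oppr_ge0 ?(ltW x0)// sub0r opprK.
have maxn (x : R) : Num.max (1 * x) 0 + Num.max (-1 * x) 0 = `|x| :> R.
  rewrite mul1r mulN1r; have [x0|x0] := leP 0 x.
    by rewrite max_r ?oppr_le0// addr0 ger0_norm.
  by rewrite max_l ?oppr_ge0 ?(ltW x0)// add0r ltr0_norm.
have close n v : (f v - g n v) ^+ 2 <= f v ^+ 2.
  rewrite -[leRHS]real_normK ?num_real// -[leLHS]real_normK ?num_real//.
  rewrite ler_pXn2r ?nnegrE// gE.
  have := hle n (f v); have := kle n (f v); have := maxE (f v); have := maxn (f v).
  move=> H1 H2 /andP[? ?] /andP[? ?]; rewrite -[in leRHS]H1 -[X in `|X - _|]H2.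
  by rewrite ler_norml; apply/andP; split; lra.
have mg n : measurable_fun setT (g n).
  by have [+ _] := hg n; rewrite inE => /andP[]; rewrite inE.
have msq n : measurable_fun setT (fun v => ((f v - g n v) ^+ 2)%:E).
  by apply/measurable_EFinP; apply: measurable_funX; exact: measurable_funB.
have cvg0 v : ((f v - g n v) ^+ 2)%:E @[n --> \oo] --> 0%E.
  apply/fine_cvgP; split; first by near=> n.
  rewrite /= (_ : 0 = (f v - f v) * (f v - f v)); last by rewrite subrr mulr0.
  under eq_fun do rewrite expr2.
  suff fg : f v - g n v @[n --> \oo] --> f v - f v by exact: (cvgM fg fg).
  apply: cvgB; first exact: cvg_cst.
  under eq_fun do rewrite gE.
  have hk := cvgB (hcvg (f v)) (kcvg (f v)); rewrite maxE in hk; exact: hk.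
have dom : {ae mu, forall v n, setT v ->
    (`|((f v - g n v) ^+ 2)%:E| <= (EFin \o (fun v => f v ^+ 2)%R) v)%E}.
  by apply: aeW => v n _; rewrite /= ger0_norm ?sqr_ge0// lee_fin close.
have cvg0' : {ae mu, forall v, setT v -> ((f v - g n v) ^+ 2)%:E @[n --> \oo] --> 0%E}.
  by apply: aeW.
have [_ _] := dominated_convergence measurableT msq
  (measurable_cst _) cvg0' (Lfun2_integrable_sqr f2) dom.
rewrite integral0 => /fine_cvgP[fin /cvgrPdist_le/(_ _ (exprn_gt0 2 e2)) near0].
near \oo => n.
exists (g n); split => //.
apply: sd_le; [by apply: L2B => //; case: (hg n)|exact: ltW|].
rewrite unlock.
have finn : (\int[mu]_x ((f x - g n x) ^+ 2)%:E)%E \is a fin_num by near: n.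
rewrite -[leLHS](fineK finn) lee_fin.
apply: le_trans (ler_norm _) _; rewrite -normrN -[- _]add0r.
by near: n.
Unshelve. all: by end_near.
Qed.

End approximation.

(** * Bounds on the correlation coefficient *)

Lemma sup_le_bound (R : realType) (E : set R) r : 0 <= r -> ubound E r -> sup E <= r.
Proof.
move=> r0 Er; have [->|/set0P E0] := eqVneq E set0; first by rewrite sup0.
exact: ge_sup.
Qed.

Section rho_sigma.
Variables (R : realType) (d : measure_display) (T : measurableType d) (P : probability T R).
Implicit Types A B : set (set T).

Lemma rho_sigma_le r A B : 0 <= r ->
  (forall f g, f \in Lfun P 2%:E -> g \in Lfun P 2%:E -> measurable_wrt A f ->
     measurable_wrt B g -> `|corr P f g| <= r) -> rho_sigma P A B <= r.
Proof. by move=> r0 H; apply: sup_le_bound => // _ [f [g [? ? ? ? ->]]]; exact: H. Qed.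

Lemma rho_sigma_le1 A B : rho_sigma P A B <= 1.
Proof. by apply: rho_sigma_le => // f g f2 g2 _ _; exact: corr_le1. Qed.

Lemma rho_sigma_ge A B f g : f \in Lfun P 2%:E -> g \in Lfun P 2%:E ->
  measurable_wrt A f -> measurable_wrt B g -> `|corr P f g| <= rho_sigma P A B.
Proof.
move=> f2 g2 mf mg; apply: ub_le_sup; last by exists f, g.
by exists 1 => _ [f' [g' [f'2 _ g'2 _ ->]]]; exact: corr_le1.
Qed.

End rho_sigma.

Section field_rho.
Variables (R : realType) (dim : nat) (m : nat -> nat) (kappa : nat -> nat -> Zd dim).
Variables (c : nat -> R) (dec : nat -> nat * nat) (mu : probability (bitspace (site dim)) R).
Hypothesis m_gt1 : forall b, (1 < m b)%N.
Hypothesis kappa_inj : forall b i i', (i < m b)%N -> (i' < m b)%N ->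
  kappa b i = kappa b i' -> i = i'.
Hypothesis c01 : forall b, 0 <= c b <= 1.
Hypothesis dec_inj : injective dec.
Hypothesis dec_surj : forall q, exists i, dec i = q.
Hypothesis mu_flip : forall b j s s' A,
  (s < m b)%N -> (s' < m b)%N -> s != s' -> measurable A ->
  mu (flip [:: (b, j, s); (b, j, s')] @^-1` A) = mu A.
Hypothesis mu_flip1 : forall b j s A, (m b <= s)%N -> measurable A ->
  mu (flip [:: (b, j, s)] @^-1` A) = mu A.
Hypothesis mu_blocks : forall M (Q : seq (nat * Zd dim)) (x : nat * Zd dim -> nat -> bool),
  uniq Q -> (forall q, q \in Q -> (m q.1 <= M)%N) ->
  mu [set v | forall q s, q \in Q -> (s < M)%N -> v (q, s) = x q s] =
  (\prod_(q <- Q) (2 ^- M * (1 + c q.1 * \prod_(s < m q.1) (-1) ^+ x q s)))%:E.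

Local Notation I := (site dim).
Local Notation config := (bitspace I).
Local Notation X := (@field R dim kappa dec).
Local Notation fsite := (field_site kappa dec).

Let m_gt0 b : (0 < m b)%N. Proof. exact: ltnW. Qed.

Let sites (S : set (Zd dim)) : set I := [set t | exists k i, S k /\ t = fsite k i].

Lemma gen_sigma_approx S A : gen_sigma X S A -> approx_set m mu (sites S) A.
Proof.
apply: smallest_sub; first exact: approx_set_sigma_algebra mu_blocks _.
move=> _ [k [Sk [B [mB ->]]]].
apply: (approx_set_bits mu_blocks (f := fsite k) (C := @binary R @^-1` B)).
  by move=> i; exists k, i.
by rewrite -[X in measurable X]setTI; apply: measurable_binary.
Qed.

Let sites_block S q s : sites S (q, s) -> S (q.2 + kappa q.1 s).
Proof.
by move=> [k [i [Sk]]]; case: q => b j; rewrite /field_site => -[-> -> ->]; rewrite /= subrK.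
Qed.

(** A translate of a block counts only if [S] and [S'] together contain all its sites and each
    contains one; if a site is missed, its bias is invisible even to both sides together. *)
Lemma field_rho_le S S' r : 0 <= r -> (forall k, S k -> S' k -> False) ->
  (forall b j, (forall s, (s < m b)%N -> S (j + kappa b s) \/ S' (j + kappa b s)) ->
     (exists2 s, (s < m b)%N & S (j + kappa b s)) ->
     (exists2 s, (s < m b)%N & S' (j + kappa b s)) -> c b <= r) ->
  rho_sigma mu (gen_sigma X S) (gen_sigma X S') <= r.
Proof.
move=> r0 SS' split_r; apply: rho_sigma_le => // f g f2 g2 mf mg.
apply: corr_bound => //.
have [_ af] := approx_fun_measurable mu_blocks f2 (fun B mB => gen_sigma_approx (mf B mB)).
have [_ ag] := approx_fun_measurable mu_blocks g2 (fun B mB => gen_sigma_approx (mg B mB)).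
apply: cov_bound_limit => // e e0 _.
have [f' [df' ff']] := af e e0; have [g' [dg' gg']] := ag e e0.
exists f', g'; split => //;
  try by [exact: (finite_dep_L2 mu_blocks df')|exact: (finite_dep_L2 mu_blocks dg')].
apply: (finite_dep_cov m_gt0 c01 mu_blocks r0 _ _ df' dg').
  by move=> t [k [i [Sk ->]]] [k' [i' [S'k' /(field_site_inj dec_inj)[kk' _]]]];
    apply: (SS' k); rewrite // kk'.
move=> [b j] h1 [s1 sm1 /sites_block h2] [s2 sm2 /sites_block h3]; apply: (split_r b j).
- by move=> s sm; have [/sites_block|/sites_block] := h1 s sm; [left|right].
- by exists s1.
- by exists s2.
Qed.

Let enc q : nat := projT1 (cid (dec_surj q)).

Let encK q : dec (enc q) = q. Proof. exact: projT2 (cid (dec_surj q)). Qed.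

(** * Lower bound from a split block *)

Section split_block.
Variables (b : nat) (S S' : set (Zd dim)).
Hypothesis SS' : forall k, S k -> S' k -> False.
Hypothesis block_split : forall s, (s < m b)%N -> S (kappa b s) \/ S' (kappa b s).
Hypothesis block_S : exists2 s, (s < m b)%N & S (kappa b s).
Hypothesis block_S' : exists2 s, (s < m b)%N & S' (kappa b s).

Let in_block (U : set (Zd dim)) : pred 'I_(m b) := fun i => `[< U (kappa b i) >].

(** [measurable_wrt] asks for exact measurability, so the test functions are built from digits of
    the field. Moments are computed for [sign], the product of the actual bits, which agrees with it
    almost surely. *)
Let decoded_sign (U : set (Zd dim)) (v : config) : R :=
  \prod_(i < m b | in_block U i) (-1) ^+ digit (enc (b, nat_of_ord i)) (X (kappa b i) v).

Let sign (U : set (Zd dim)) (v : config) : R :=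
  \prod_(i < m b | in_block U i) (-1) ^+ v ((b, 0), nat_of_ord i).

Let fsite_enc (i : 'I_(m b)) : fsite (kappa b i) (enc (b, nat_of_ord i)) = ((b, 0), nat_of_ord i).
Proof. by rewrite /field_site encK /= subrr. Qed.

Let norm_sign (x : 'I_(m b) -> bool) U : `|\prod_(i < m b | in_block U i) (-1) ^+ x i : R| = 1.
Proof.
by rewrite normr_prod big1// => i _; rewrite normrX normrN1 expr1n.
Qed.

Let measurable_wrt_decoded U : measurable_wrt (gen_sigma X U) (decoded_sign U).
Proof.
(* The sample space carrying the sigma-algebra [gen_sigma X U], so that the usual rules for
   measurable functions yield [measurable_wrt]. *)
pose G := g_sigma_algebraType [set A | exists k, U k /\ exists B : set R,
  measurable B /\ A = X k @^-1` B].
have mX k : U k -> measurable_fun setT (X k : G -> R).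
  move=> Uk _ B mB; rewrite setTI; apply: sub_sigma_algebra.
  by exists k; split => //; exists B.
have mg : measurable_fun setT (decoded_sign U : G -> R).
  rewrite (_ : decoded_sign U = fun v => \prod_(i < m b) (if in_block U i then
      (-1) ^+ digit (enc (b, nat_of_ord i)) (X (kappa b i) v) else 1)); last first.
    by apply/funext => v; rewrite /decoded_sign big_mkcond.
  apply: measurable_prod => i _; case: (boolP (in_block U i)) => [/asboolP Ui|_].
    apply: (measurableT_comp (f := fun x : R => (-1) ^+ digit (enc (b, nat_of_ord i)) x : R)).
      rewrite (_ : (fun x => _) = (fun x =>
          1 - 2 * \1_[set x : R | digit (enc (b, nat_of_ord i)) x] x)).
        apply: measurable_funB => //; apply: measurable_funM => //.
        by apply: measurable_indic; exact: measurable_digit.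
      apply/funext => x; rewrite indicE; have [h|h] := boolP (digit _ x).
        by rewrite mem_set//= expr1 mulr1n; lra.
      by rewrite memNset/= ?expr0 ?mulr0n; [lra|exact/negP].
    exact: mX.
  exact: measurable_cst.
by move=> B mB; have := mg measurableT B mB; rewrite setTI.
Qed.

Let field_measurable k : measurable_fun setT (X k). Proof. exact: measurable_field. Qed.

Let measurable_decoded U : measurable_fun setT (decoded_sign U).
Proof.
move=> _ B mB; rewrite setTI; have := @measurable_wrt_decoded U B mB.
apply: smallest_sub; first exact: sigma_algebra_measurable.
move=> _ [k [_ [B' [mB' ->]]]]; rewrite -[X in measurable X]setTI; exact: field_measurable.
Qed.

Let decoded_L2 U : decoded_sign U \in Lfun mu 2%:E.
Proof.
apply: (@L2_bounded _ _ _ _ _ 1); first exact: measurable_decoded.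
by move=> v; rewrite norm_sign.
Qed.

Let block_sites : set I := [set t | t.1 \in [:: (b, 0 : Zd dim)] /\ (t.2 < m b)%N].

Let block_seq U V : depends_on block_sites U -> depends_on block_sites V ->
  depends_on block_sites (fun v : config => (U v * V v : R)).
Proof. by move=> dU dV v w vw; rewrite (dU v w vw) (dV v w vw). Qed.

Let sign_dep U : depends_on block_sites (sign U).
Proof.
move=> v w vw; apply: eq_bigr => i _; rewrite vw//; split; first by rewrite inE eqxx.
exact: ltn_ord.
Qed.

Let block_expectation (F : config -> R) : depends_on block_sites F ->
  ('E_mu[F] = (\sum_(x : {ffun 'I_(m b) -> bool}) 2 ^- m b *
      (1 + c b * \prod_(i < m b | (i < m b)%N) (-1) ^+ x i) *
      F (set_block (b, 0) x point))%:E)%E.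
Proof.
move=> dF; have mQ q : q \in [:: (b, 0 : Zd dim)] -> (m q.1 <= m b)%N.
  by rewrite inE => /eqP ->.
by have [_ ->] := @expectation_block_avg R dim m c mu mu_blocks (m b) [:: (b, 0)] F point isT mQ dF.
Qed.

Let set_blockE (x : {ffun 'I_(m b) -> bool}) (i : 'I_(m b)) :
  set_block (b, 0) x (point : config) ((b, 0), nat_of_ord i) = x i.
Proof.
rewrite /set_block/= eqxx; case: insubP => [j _ ji|]; last by rewrite ltn_ord.
by congr (x _); exact: val_inj.
Qed.

Let sign_set_block U x : sign U (set_block (b, 0) x point) =
  \prod_(i < m b | in_block U i) (-1) ^+ x i.
Proof. by apply: eq_bigr => i _; rewrite set_blockE. Qed.

Let K0 : exists j : 'I_(m b), (j < m b)%N.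
Proof. by exists (Ordinal (m_gt0 b)). Qed.

Let sign_mean U (j k : 'I_(m b)) : U (kappa b j) -> ~ U (kappa b k) -> ('E_mu[sign U])%E = 0%E.
Proof.
move=> Uj Uk; rewrite block_expectation; last exact: sign_dep.
congr EFin; under eq_bigr do rewrite sign_set_block.
apply: (@block_sign_mean R (m b) [pred i : 'I_(m b) | (i < m b)%N] (c b) (in_block U) j k).
- exact/asboolP.
- exact: (ltn_ord k).
- exact/asboolPn.
Qed.

Let sign_product : ('E_mu[(fun v => sign S v * sign S' v)%R])%E = (c b)%:E.
Proof.
rewrite block_expectation; last by apply: block_seq; exact: sign_dep.
congr EFin; rewrite -[RHS](block_sign_product (c b) K0).
apply: eq_bigr => x _; congr (_ * _); rewrite !sign_set_block.
rewrite [RHS](bigID (in_block S))/=; congr (_ * _); apply: eq_bigl => i; rewrite ltn_ord//=.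
apply/asboolP/idP => [S'i|/asboolPn nS].
  by apply/asboolPn => Si; exact: (SS' Si S'i).
by have [] := block_split (ltn_ord i).
Qed.

Let sign_sqr U v : sign U v * sign U v = 1.
Proof.
by rewrite /sign -big_split/= big1// => i _; rewrite -expr2 sqrr_sign.
Qed.

Let sign_L2 U : sign U \in Lfun mu 2%:E.
Proof.
apply: (@finite_dep_L2 R dim m c mu mu_blocks setT); exists [:: (b, 0)], (m b); split => //.
  by move=> q; rewrite inE => /eqP ->.
by move=> v w vw; apply: sign_dep => t bt; exact: vw.
Qed.

(** Stated as a vanishing standard deviation, which by [cov_sd] is enough to exchange the two
    functions inside covariances. *)
Let decoded_ae U : sd mu (decoded_sign U \- sign U) = 0.
Proof.
apply/eqP; rewrite eq_le sd_ge0 andbT; apply: sd_le; [exact: L2B|by []|].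
rewrite unlock (_ : (\int[mu]_w _)%E = 0%E) ?expr0n//.
rewrite -(integral0 mu setT); apply: ae_eq_integral => //.
- apply/measurable_EFinP; apply: measurable_funX; apply: measurable_funB.
    exact: measurable_decoded.
  by have := sign_L2 U; rewrite inE => /andP[]; rewrite inE.
- have H (i : 'I_(m b)) : {ae mu, forall v,
      digit (enc (b, nat_of_ord i)) (X (kappa b i) v) = v ((b, 0), nat_of_ord i)}.
    have mD : measurable [set v : config |
        digit (enc (b, nat_of_ord i)) (X (kappa b i) v) = v ((b, 0), nat_of_ord i)].
      have m1 : measurable [set v : config | digit (enc (b, nat_of_ord i)) (X (kappa b i) v)].
        rewrite -[X in measurable X]setTI.
        have mD := @measurable_digit R (enc (b, nat_of_ord i)).
        exact: (@field_measurable (kappa b i) measurableT _ mD).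
      rewrite (_ : [set _ | _] =
        ([set v : config | digit (enc (b, nat_of_ord i)) (X (kappa b i) v)] `&`
           [set v : config | v ((b, 0), nat_of_ord i) = true]) `|`
        (~` [set v : config | digit (enc (b, nat_of_ord i)) (X (kappa b i) v)] `&`
           [set v : config | v ((b, 0), nat_of_ord i) = false])).
        apply: measurableU; apply: measurableI => //; try exact: measurable_bit.
        exact: measurableC.
      apply/seteqP; split => v /=.
        by case: (digit _ _) => <-; [left|right].
      by move=> [[-> ->]|[/negP/negbTE -> ->]].
    exists (~` [set v : config |
        digit (enc (b, nat_of_ord i)) (X (kappa b i) v) = v ((b, 0), nat_of_ord i)]).
    split; [exact: measurableC| |by []].
    rewrite probability_setC//.
    have := @field_decode R dim m kappa dec mu kappa_inj dec_inj mu_flip mu_flip1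
      (kappa b i) (enc (b, nat_of_ord i)) m_gt1.
    by rewrite fsite_enc => ->; rewrite subee.
  have : {ae mu, forall v, forall i : 'I_(m b),
      digit (enc (b, nat_of_ord i)) (X (kappa b i) v) = v ((b, 0), nat_of_ord i)}.
    exact: filter_forall.
  apply: filterS => v hv _ /=; rewrite /decoded_sign /sign.
  by under eq_bigr do rewrite hv; rewrite subrr expr0n.
Qed.

Lemma split_block_rho : c b <= rho_sigma mu (gen_sigma X S) (gen_sigma X S').
Proof.
case: block_S => s sm Ss; case: block_S' => s' s'm S's'.
have nS : ~ S (kappa b (Ordinal s'm)) by move=> h; exact: (SS' h S's').
have nS' : ~ S' (kappa b (Ordinal sm)) by move=> h; exact: (SS' Ss h).
have ES := @sign_mean S (Ordinal sm) (Ordinal s'm) Ss nS.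
have ES' := @sign_mean S' (Ordinal s'm) (Ordinal sm) S's' nS'.
have CE (f g : config -> R) : f \in Lfun mu 2%:E -> g \in Lfun mu 2%:E ->
    covariance mu f g = ('E_mu[f * g] - 'E_mu[f] * 'E_mu[g])%E.
  by move=> f2 g2; apply: covarianceE; [exact: L2_L1|exact: L2_L1|exact: Lfun2_mul_Lfun1].
have V U : ('E_mu[sign U])%E = 0%E -> sd mu (sign U) = 1.
  move=> EU; rewrite /sd /cov CE ?sign_L2// EU mule0 sube0.
  rewrite (_ : (sign U * sign U)%R = cst 1); last by apply/funext => v; exact: sign_sqr.
  by rewrite expectation_cst sqrtr1.
have C : cov mu (sign S) (sign S') = c b.
  rewrite /cov CE ?sign_L2// ES mul0e sube0.
  by rewrite [X in ('E_mu[X])%E](_ : _ = (fun v => sign S v * sign S' v)) ?sign_product.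
have sd_dec U : sd mu (decoded_sign U) = sd mu (sign U).
  have D2 := decoded_L2 U; have S2 := sign_L2 U.
  apply/eqP; rewrite eq_le; apply/andP; split.
    have -> : decoded_sign U = (decoded_sign U \- sign U) \+ sign U.
      by apply/funext => v /=; rewrite subrK.
    by apply: le_trans (sdD _ _) _; rewrite ?L2B// decoded_ae add0r.
  have {1}-> : sign U = (sign U \- decoded_sign U) \+ decoded_sign U.
    by apply/funext => v /=; rewrite subrK.
  by apply: le_trans (sdD _ _) _; rewrite ?L2B// sd_sub// decoded_ae add0r.
have C' : cov mu (decoded_sign S) (decoded_sign S') = c b.
  rewrite -C; have D2 U := decoded_L2 U; have S2 U := sign_L2 U.
  have h1 : cov mu (decoded_sign S \- sign S) (decoded_sign S') = 0.
    apply/eqP; rewrite -normr_le0; apply: le_trans (cov_sd _ _) _; rewrite ?L2B//.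
    by rewrite decoded_ae mul0r.
  have h2 : cov mu (sign S) (decoded_sign S' \- sign S') = 0.
    apply/eqP; rewrite -normr_le0; apply: le_trans (cov_sd _ _) _; rewrite ?L2B//.
    by rewrite decoded_ae mulr0.
  move: h1; rewrite covBl// => h1.
  move: h2; rewrite covC covBl// (covC mu (decoded_sign S')) (covC mu (sign S')) => h2.
  lra.
have := rho_sigma_ge (decoded_L2 S) (decoded_L2 S') (@measurable_wrt_decoded S)
  (@measurable_wrt_decoded S').
apply: le_trans; rewrite /corr -[fine (covariance _ _ _)]/(cov _ _ _) C'.
have Vd U : fine ('V_mu[decoded_sign U])%E = sd mu (decoded_sign U) ^+ 2 by rewrite sd_sqr.
by rewrite !Vd !sd_dec !V// !expr1n mulr1 sqrtr1 divr1 ler_norm.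
Qed.

End split_block.

End field_rho.

(** * The geometry of the blocks *)

Lemma chain_one_side (G H : set int) (n : int) (a : nat -> int) L :
  (forall g h, G g -> H h -> n <= `|g - h|) ->
  (forall s, (s <= L)%N -> G (a s) \/ H (a s)) ->
  (forall s, (s < L)%N -> `|a s - a s.+1| < n) ->
  (forall s, (s <= L)%N -> G (a s)) \/ (forall s, (s <= L)%N -> H (a s)).
Proof.
move=> GH; elim: L => [|L IH] cover step.
  by case: (cover 0%N (leqnn _)) => h; [left|right] => s; rewrite leqn0 => /eqP ->.
have stepL := step L (ltnSn L).
have [G0|H0] := IH (fun s sL => cover s (leqW sL)) (fun s sL => step s (ltnW sL)).
- case: (cover _ (leqnn L.+1)) => h.
    by left => s; rewrite leq_eqVlt => /orP[/eqP -> //|]; exact: G0.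
  by have := GH _ _ (G0 L (leqnn L)) h; rewrite leNgt stepL.
- case: (cover _ (leqnn L.+1)) => h; last first.
    by right => s; rewrite leq_eqVlt => /orP[/eqP -> //|]; exact: H0.
  by have := GH _ _ h (H0 L (leqnn L)); rewrite distrC leNgt stepL.
Qed.

Lemma pairing_exists :
  exists dec : nat -> nat * nat, injective dec /\ forall q, exists i, dec i = q.
Proof.
have : ([set: nat] #= [set: nat * nat])%card by rewrite card_eq_sym card_nat2.
move=> /card_set_bijP[f [_ finj fsurj]]; exists f; split.
  by move=> i j; apply: finj; rewrite inE.
by move=> q; have [i _ <-] := fsurj q I; exists i.
Qed.

Section construction.
Variables (R : realType) (d' N : nat) (c : nat -> R).
Hypothesis c01 : forall n, (1 <= n)%N -> 0 <= c n <= 1.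
Hypothesis c_dec : forall n, (1 <= n)%N -> c n.+1 <= c n.

Local Notation dim := (d'.+2).

Let u0 : 'I_dim := ord0.
Let u1 : 'I_dim := lift ord0 ord0.

(* Even labels b carry an arithmetic progression of step b/2 + 1 along the first axis;
   odd labels carry a long diagonal together with one remote corner. *)
Definition block_size (b : nat) : nat := if odd b then (N + b).+2 else N.+1.

(** The diagonal of an odd block lengthens with [b], so the distance from the corner to the diagonal
    is unbounded over the odd labels, and one field serves [rhostar_X] for all [n]. *)
Definition block_site (b i : nat) : Zd dim :=
  if odd b then
    if (i <= N + b)%N then \row_(u < dim) i%:Z
    else \row_(u < dim) (if u == u0 then (N + b)%:Z else 0)
  else \row_(u < dim) (if u == u0 then (i * (b./2).+1)%:Z else 0).

(** Adding 1 to [b./2] starts both the steps and the indices of [c] at 1, where the hypotheses on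
    [c] begin. *)
Definition block_coef (b : nat) : R := if odd b then 1 else c (b./2).+1.

Lemma block_size_gt b : (N < block_size b)%N.
Proof. by rewrite /block_size; case: ifP => _; lia. Qed.

Lemma block_coef01 b : 0 <= block_coef b <= 1.
Proof. by rewrite /block_coef; case: ifP => _; [rewrite ler01 lexx|exact: c01]. Qed.

Lemma block_site_inj b i i' : (i < block_size b)%N -> (i' < block_size b)%N ->
  block_site b i = block_site b i' -> i = i'.
Proof.
rewrite /block_size /block_site; case: ifP => ob ib i'b h.
  (* Two coordinates are needed: the corner agrees with the last diagonal site in the first one and
     with the initial site in the second. *)
  have h0 : coord (block_site b i) u0 = coord (block_site b i') u0 by rewrite /block_site ob h.
  have h1 : coord (block_site b i) u1 = coord (block_site b i') u1 by rewrite /block_site ob h.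
  move: h0 h1; rewrite /coord /block_site ob.
  by case: (leqP i (N + b)) => iN; case: (leqP i' (N + b)) => i'N; rewrite !mxE/=; lia.
have : coord (block_site b i) u0 = coord (block_site b i') u0 by rewrite /block_site ob h.
rewrite /coord /block_site ob !mxE/= => -[] /eqP.
by rewrite eqn_mul2r/= => /eqP.
Qed.

Lemma block_not_split (n : nat) b (j : Zd dim) (u : 'I_dim) (G H : set int) : (2 <= n)%N ->
  (forall g h, G g -> H h -> n%:Z <= `|g - h|) ->
  (forall s, (s < block_size b)%N ->
     G (coord (j + block_site b s) u) \/ H (coord (j + block_site b s) u)) ->
  (exists2 s, (s < block_size b)%N & G (coord (j + block_site b s) u)) ->
  (exists2 s, (s < block_size b)%N & H (coord (j + block_site b s) u)) ->
  block_coef b <= c n.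
Proof.
move=> n2 GH cover [s sb Gs] [t tb Ht].
have c_mono p q : (1 <= p)%N -> (p <= q)%N -> c q <= c p.
  move=> p1; elim: q => [|q IH]; first by lia.
  rewrite leq_eqVlt => /orP[/eqP -> //|pq]; apply: le_trans (c_dec _) (IH pq).
  exact: leq_trans p1 pq.
have GH0 x : G x -> H x -> False.
  by move=> Gx Hx; have := GH _ _ Gx Hx; rewrite subrr normr0; lia.
pose a s := coord (j + block_site b s) u.
have [ob|ob] := boolP (odd b).
  (* Along the diagonal every coordinate moves by 1, which is less than [n] exactly because
     [n >= 2]. *)
  have [] := @chain_one_side G H n%:Z a (N + b)%N GH.
  - by move=> i iL; apply: cover; rewrite /block_size ob; lia.
  - by move=> i iL; rewrite /a /coord /block_site ob !mxE ltnW// iL !mxE; lia.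
  (* With the diagonal in [G], only the corner could be in [H]; but its coordinate [u] is that of
     diagonal site [N + b] or 0. *)
  - move=> GL; exfalso.
    have [tL|tL] := leqP t (N + b); first by apply: (GH0 _ (GL t tL) Ht).
    have : coord (j + block_site b t) u = a (if u == u0 then (N + b)%N else 0%N).
      rewrite /a /coord /block_site ob leqNgt tL /= !mxE.
      by case: (u == u0); rewrite ?leqnn ?leq0n !mxE.
    by move=> e; rewrite e in Ht; apply: (GH0 _ _ Ht); apply: GL; case: ifP; lia.
  - move=> HL; exfalso.
    have [sL|sL] := leqP s (N + b); first by apply: (GH0 _ Gs (HL s sL)).
    have : coord (j + block_site b s) u = a (if u == u0 then (N + b)%N else 0%N).
      rewrite /a /coord /block_site ob leqNgt sL /= !mxE.
      by case: (u == u0); rewrite ?leqnn ?leq0n !mxE.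
    by move=> e; rewrite e in Gs; apply: (GH0 _ Gs); apply: HL; case: ifP; lia.
(* For a step of at least [n] the bound is monotonicity of [c]. For a smaller step the sites form a
   chain, constant along every axis but the first, that cannot be split. *)
rewrite /block_coef (negbTE ob); have [nb|bn] := leqP n (b./2).+1.
  by apply: c_mono => //; lia.
have [] := @chain_one_side G H n%:Z a N GH.
- by move=> i iL; apply: cover; rewrite /block_size (negbTE ob); lia.
- move=> i iL; rewrite /a /coord /block_site (negbTE ob) !mxE.
  by case: (u == u0); [rewrite mulSn; lia|lia].
- move=> GL; exfalso; apply: (GH0 _ (GL t _) Ht).
  by move: tb; rewrite /block_size (negbTE ob).
- move=> HL; exfalso; apply: (GH0 _ Gs (HL s _)).
  by move: sb; rewrite /block_size (negbTE ob).
Qed.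

End construction.

(** * Choice of a block for each distance, and assembly *)

Theorem theorem1p5 (R : realType) (dim N : nat) (c : nat -> R) :
  (2 <= dim)%N -> (2 <= N)%N ->
  (forall n, (1 <= n)%N -> 0 <= c n <= 1) ->
  (forall n, (1 <= n)%N -> c n.+1 <= c n) ->
  exists (dd : measure_display) (Omega : measurableType dd)
         (P : probability Omega R) (X : Zd dim -> Omega -> R),
    [/\ random_field X /\ strictly_stationary P X,
        uniform01 P (X 0),
        tuplewise_indep P N X,
        (forall n, (1 <= n)%N -> rhostar_X P X n = 1) /\
        (rho_X P X 1 = 1 /\ rho'_X P X 1 = 1) &
        (forall n, (2 <= n)%N -> rho_X P X n = c n /\ rho'_X P X n = c n)].
Proof.
case: dim => [//|[//|d']] _ N2 c01 c_dec.
pose m := block_size N; pose kappa := @block_site d' N; pose cc := block_coef c.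
have m_gtN b : (N < m b)%N := block_size_gt N b.
have m_gt1 b : (1 < m b)%N := ltn_trans N2 (m_gtN b).
have m_gt0 b : (0 < m b)%N := ltnW (m_gt1 b).
have cc01 := block_coef01 c01; rewrite -/cc in cc01.
have ccn b : `|cc b| <= 1 by have /andP[h0 h1] := cc01 b; rewrite ger0_norm.
have kappa_inj := @block_site_inj d' N; rewrite -/m -/kappa in kappa_inj.
have [dec [dec_inj dec_surj]] := pairing_exists.
have [mu [mu_translate mu_flip mu_flip1 mu_blocks]] := @block_measure_exists R d'.+2 m cc m_gt0 ccn.
pose X := @field R d'.+2 kappa dec.
have rho_le n u G H : (2 <= n)%N -> (forall g h, G g -> H h -> n%:Z <= `|g - h|) ->
    rho_sigma mu (gen_sigma X [set k | G (coord k u)]) (gen_sigma X [set k | H (coord k u)]) <= c n.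
  move=> n2 GH; have /andP[cn0 _] := c01 n (ltnW n2).
  apply: (field_rho_le m_gt1 cc01 dec_inj mu_blocks cn0).
    by move=> k /= Gk Hk; have := GH _ _ Gk Hk; rewrite subrr normr0; lia.
  by move=> b j; exact: (block_not_split c_dec n2 GH).
have rho_ge := split_block_rho m_gt1 kappa_inj dec_inj dec_surj mu_flip mu_flip1 mu_blocks.
rewrite -/X in rho_ge.
pose u0 : 'I_d'.+2 := ord0.
(* The same two half-spaces serve for [rho_X] and [rho'_X]: they separate site number 0 of the block
   from all its other sites. *)
have step_split n : (1 <= n)%N -> exists b, (n = 1%N -> cc b = 1) /\ ((2 <= n)%N -> cc b = c n) /\
   cc b <= rho_sigma mu (gen_sigma X [set k | coord k u0 <= 0])
                        (gen_sigma X [set k | 0 + n%:Z <= coord k u0]).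
  (* Label 1 has coefficient 1; for [n >= 2] the label [2 * (n - 1)] has step [n] and coefficient
     [c n]. *)
  move=> n1; pose b := if n == 1%N then 1%N else (n.-1).*2.
  exists b; split; first by rewrite /b => ->.
  have kappa0 : coord (kappa b 0) u0 = 0.
    rewrite /kappa /block_site /coord; case: ifP => _; last by rewrite mxE /= mul0n.
    by rewrite mxE.
  have kappaS s : (0 < s < m b)%N -> n%:Z <= coord (kappa b s) u0.
    rewrite /kappa /block_site /m /block_size /coord /b; case: eqP => [->/=|n1' ].
      by case: ifP => _; rewrite mxE/=; lia.
    by rewrite odd_double mxE/= doubleK prednK//; nia.
  split.
    move=> n2; rewrite /cc /block_coef /b; case: eqP => [n1'|_]; first by rewrite n1' in n2.
    by rewrite odd_double doubleK prednK.
  apply: rho_ge.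
  - by move=> k /= h1; rewrite add0r => h2; have := le_trans h2 h1; lia.
  - move=> [|s] sm; first by left; rewrite /= kappa0.
    by right; rewrite /= add0r kappaS// sm.
  - by exists 0%N; rewrite /= ?kappa0.
  - by exists 1%N; rewrite /= ?add0r ?kappaS ?m_gt1.
have rhoX_ge n : (1 <= n)%N -> exists b, (n = 1%N -> cc b = 1) /\ ((2 <= n)%N -> cc b = c n) /\
    cc b <= rho_X mu X n.
  move=> n1; have [b [h1 [h2 h3]]] := step_split n n1; exists b; split; [|split] => //.
  apply: le_trans h3 _; apply: ub_le_sup; last by exists 0, u0.
  by exists 1 => _ [j [u ->]]; exact: rho_sigma_le1.
have rho'X_ge n : (1 <= n)%N -> exists b, (n = 1%N -> cc b = 1) /\ ((2 <= n)%N -> cc b = c n) /\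
    cc b <= rho'_X mu X n.
  move=> n1; have [b [h1 [h2 h3]]] := step_split n n1; exists b; split; [|split] => //.
  apply: le_trans h3 _; apply: ub_le_sup.
    by exists 1 => _ [u [G [H [_ _ _ _ ->]]]]; exact: rho_sigma_le1.
  exists u0, [set x | x <= 0], [set x | 0 + n%:Z <= x]; split => //.
  - by exists 0 => /=.
  - by exists n%:Z => /=; rewrite add0r.
  - by apply/disj_setPS => x [/= x0]; rewrite add0r => /(le_trans)/(_ x0); lia.
  - by move=> g h /= g0; rewrite add0r => h0; lia.
have rhoX_le1 n : rho_X mu X n <= 1.
  by apply: sup_le_bound => // _ [j [u ->]]; exact: rho_sigma_le1.
have rho'X_le1 n : rho'_X mu X n <= 1.
  by apply: sup_le_bound => // _ [u [G [H [_ _ _ _ ->]]]]; exact: rho_sigma_le1.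
have rhoX_le n : (2 <= n)%N -> rho_X mu X n <= c n.
  move=> n2; have /andP[cn0 _] := c01 n (ltnW n2).
  apply: sup_le_bound => // _ [j [u ->]].
  apply: (rho_le n u [set x | x <= j] [set x | j + n%:Z <= x] n2) => g h /= gj jh.
  by lia.
have rho'X_le n : (2 <= n)%N -> rho'_X mu X n <= c n.
  move=> n2; have /andP[cn0 _] := c01 n (ltnW n2).
  by apply: sup_le_bound => // _ [u [G [H [_ _ _ GH ->]]]]; exact: rho_le.
have rhostar n : (1 <= n)%N -> rhostar_X mu X n = 1.
  move=> n1; apply/eqP; rewrite eq_le; apply/andP; split.
    by apply: sup_le_bound => // _ [S [T [_ _ _ _ ->]]]; exact: rho_sigma_le1.
  (* Here [L = N + 2 * n + 1], so diagonal site [i] is at distance at least [n] from the corner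
     [(L, 0, ..., 0)]: by the first coordinate if [i <= n], by the second otherwise. *)
  pose b := n.*2.+1; pose L := (N + b)%N.
  have ob : odd b by rewrite /= odd_double.
  have <- : cc b = 1 by rewrite /cc /block_coef ob.
  pose S := [set k | exists2 s, (s <= L)%N & k = kappa b s].
  pose T := [set k | k = kappa b L.+1].
  have dist s t : S s -> T t -> n%:R <= eucl_norm R (s - t).
    move=> [i iL ->] ->.
    have coord_le (k : Zd d'.+2) (u : 'I_d'.+2) : `|(coord k u)%:~R| <= eucl_norm R k.
      rewrite /eucl_norm -sqrtr_sqr ler_sqrt; last by apply: sumr_ge0 => v _; exact: sqr_ge0.
      by rewrite (bigD1 u)//= lerDl sumr_ge0// => v _; exact: sqr_ge0.
    have coord_n (k : Zd d'.+2) (u : 'I_d'.+2) : n%:Z <= `|coord k u| -> n%:R <= eucl_norm R k.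
      move=> h; apply: le_trans (coord_le k u); rewrite -intr_norm.
      by rewrite -[n%:R]/((n%:Z)%:~R) ler_int.
    have [iL2|iL2] := leqP i n.
      apply: (coord_n _ u0); rewrite /kappa /block_site /coord ob -/L iL ltnn !mxE/=.
      by rewrite /L /b; lia.
    apply: (coord_n _ (lift ord0 ord0)); rewrite /kappa /block_site /coord ob -/L iL ltnn !mxE/=.
    by lia.
  have ST k : S k -> T k -> False.
    move=> Sk Tk; have := dist _ _ Sk Tk; rewrite subrr /eucl_norm big1.
      by rewrite sqrtr0 lern0; case: (n) n1.
    by move=> u _; rewrite /coord mxE expr0n.
  have S0 : S (kappa b 0%N) by exists 0%N.
  apply: le_trans (rho_ge b S T ST _ _ _) _.
  - move=> s; rewrite /m /block_size ob -/L ltnS leq_eqVlt => /orP[/eqP ->|sL].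
      by right.
    by left; exists s.
  - by exists 0%N.
  - by exists L.+1 => //; rewrite /m /block_size ob.
  apply: ub_le_sup.
    by exists 1 => _ [S' [T' [_ _ _ _ ->]]]; exact: rho_sigma_le1.
  exists S, T; split => //.
  - by exists (kappa b 0%N).
  - by exists (kappa b L.+1).
  - by apply/disj_setPS => k [Sk Tk]; exact: ST Sk Tk.
exists _, (bitspace (site d'.+2)), mu, X; split.
- split; first by move=> k; exact: measurable_field.
  exact: field_stationary.
- by move=> B mB; apply: (field_uniform kappa_inj dec_inj mu_flip mu_flip1).
- move=> ks B ks_inj mB.
  exact: (field_tuplewise kappa_inj dec_inj mu_flip mu_flip1 m_gtN ks_inj mB).
- split=> //; have [b [h1 [_ h2]]] := rhoX_ge 1%N isT; have [b' [h1' [_ h2']]] := rho'X_ge 1%N isT.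
  rewrite h1// in h2; rewrite h1'// in h2'.
  by split; apply/eqP; rewrite eq_le ?rhoX_le1 ?rho'X_le1.
- move=> n n2; have [b [_ [h1 h2]]] := rhoX_ge n (ltnW n2).
  have [b' [_ [h1' h2']]] := rho'X_ge n (ltnW n2).
  rewrite h1// in h2; rewrite h1'// in h2'.
  by split; apply/eqP; rewrite eq_le ?rhoX_le ?rho'X_le.
Qed.
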